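(* Let $\mu$ be a probability measure on $\mathbb R^n$. Let $F:\mathbb R^+\to\mathbb R^+$ be a non-negative non-decreasing function such that there exists $\lambda\ge4$ such that for $x\ge2$, $F(x)/x$ is non-increasing and $F(\lambda x)\le\lambda F(x)/4$. Assume that for every smooth function $f$ one has $$\int f^2F\left(\frac{f^2}{\mu(f^2)}\right)d\mu\le D\int|\nabla f|^2d\mu .$$ Then for all Borel $A\subset\mathbb R^n$ with $\mu(A)\le\frac12$ it holds $$\mu(A)\,F\left(\frac{1}{\mu(A)}\right)\le4\lambda D\,\mathrm{Cap}_\mu(A).$$
   Context: $\mu(g)=\int g\,d\mu$. For a probability measure $\mu$ on $\mathbb R^n$ and a Borel set $A$ with $\mu(A)\le1/2$, $$\mathrm{Cap}_\mu(A)=\inf\left\{\int|\nabla f|^2d\mu:\ f \text{ locally Lipschitz},\ f_{|A}\ge1,\ \mu(f=0)\ge\tfrac12\right\}.$$ Measures are taken absolutely continuous with respect to Lebesgue measure when dealing with capacities. *)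

(* Defs.v *)
From HB Require Import structures.
From mathcomp Require Export all_boot all_order all_algebra.
From mathcomp Require Export all_classical all_reals all_analysis.
Export numFieldNormedType.Exports.
Export Order.TTheory GRing.Theory Num.Theory.

Set Implicit Arguments.
Unset Strict Implicit.
Unset Printing Implicit Defensive.

Local Open Scope classical_set_scope.
Local Open Scope ring_scope.

(** [R^n] is ['rV[R]_n].  The library norm on ['rV[R]_n] is the sup norm; it is
    only used below for topological or Lipschitz conditions up to an unspecified
    constant, so that it may be exchanged with the Euclidean norm. *)

(** An alias of ['rV[R]_n] carrying the Borel sigma-algebra. *)
Definition borelRn (R : realType) (n : nat) : measurableType _ :=
  g_sigma_algebraType (@open 'rV[R]_n).

(** Lebesgue measure on [R^n], as an iterated product:
    [R^(n+1)] is identified with [R * R^n] by [row_mx]. *)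
Fixpoint lebesgueRn (R : realType) (n : nat) : set (borelRn R n) -> \bar R :=
  match n return set (borelRn R n) -> \bar R with
  | 0%N => \d_ ((0 : 'rV[R]_0) : borelRn R 0)
  | m.+1 => pushforward (lebesgue_measure \x @lebesgueRn R m)%E
      (fun p : measurableTypeR R * borelRn R m =>
         row_mx ((p.1 : R)%:M : 'rV[R]_1) (p.2 : 'rV[R]_m) : borelRn R m.+1)
  end.

Definition partialRn (R : realType) (n : nat) (i : 'I_n) (f : 'rV[R]_n -> R) :
    'rV[R]_n -> R :=
  fun x => 'D_(delta_mx 0 i) f x.

(** A partial derivative that does not exist at a point has an irrelevant value
    there; for locally Lipschitz [f] this only happens on a Lebesgue-null set. *)
Definition grad (R : realType) (n : nat) (f : 'rV[R]_n -> R) (x : 'rV[R]_n) :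
    'rV[R]_n :=
  \row_i partialRn i f x.

(** Euclidean, unlike the library norm on ['rV[R]_n]. *)
Definition sqnorm (R : realType) (n : nat) (v : 'rV[R]_n) : R :=
  \sum_i v 0 i ^+ 2.

Fixpoint classC (R : realType) (n : nat) (k : nat) (f : 'rV[R]_n -> R) : Prop :=
  match k with
  | 0%N => continuous f
  | k'.+1 => continuous f /\ forall i : 'I_n,
      (forall x, derivable f x (delta_mx 0 i)) /\ classC k' (partialRn i f)
  end.

Definition smooth (R : realType) (n : nat) (f : 'rV[R]_n -> R) : Prop :=
  forall k, classC k f.

Definition locally_lipschitz (R : realType) (n : nat) (f : 'rV[R]_n -> R) :
    Prop :=
  forall x : 'rV[R]_n, exists2 U, nbhs x U & [lipschitz f y | y in U].

Definition energy (R : realType) (n : nat) (mu : set (borelRn R n) -> \bar R)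
    (f : 'rV[R]_n -> R) : \bar R :=
  \int[mu]_(x in [set: borelRn R n]) (sqnorm (grad f x))%:E.

Definition Cap (R : realType) (n : nat) (mu : set (borelRn R n) -> \bar R)
    (A : set (borelRn R n)) : \bar R :=
  ereal_inf [set energy mu f | f in
    [set f : 'rV[R]_n -> R |
      [/\ locally_lipschitz f,
          forall x, A x -> 1 <= f x
        & ((2^-1)%:E <= mu [set x | f x = 0%R])%E]]].

(* Main.v *)
From HB Require Import structures.
Require Import Defs.
From mathcomp Require Import ring lra measurable_realfun.

(** Let [f] compete in the infimum that defines the capacity of [A], and let
    [a k] be the measure of the set where [f >= 2^-k].  As [f] vanishes on a set
    of measure at least [1/2], every [a k] is at most [1/2], and [mu A <= a 0].
    Cut [f] between the levels [2^-(k+1)] and [2^-k] and rescale: the result [u]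
    has values in the unit interval, it is [1] where [f >= 2^-k], and it vanishes
    where [f < 2^-(k+1)], so that [mu(u^2) <= a (k+1)].  The assumed inequality
    for [u] gives, with a factor [4] to spare,

      [a k * F (1 / a (k+1)) <= 4^(k+1) * (4 * D * energy f)].

    Put [G a = a * F (1 / a)], which is non-decreasing below [1/2] because
    [F x / x] is non-increasing above [2].  The hypothesis on [F (lambda * x)]
    says that [G] is multiplied by at least [4] when its argument is multiplied
    by [lambda] and remains below [1/2].  Let [j] be the first index with
    [a (j+1) <= lambda * a j]; it exists since [a] is bounded, if [mu A > 0].
    Each step before [j] gains a factor [4], hence
    [G (a 0) <= G (a j) / 4^j], while at [j] the displayed inequality and the
    hypothesis on [F (lambda * x)] bound [G (a j)] by
    [lambda / 4 * 4^(j+1) * (4 * D * energy f)].  The powers of [4]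
    cancel and leave [4 * lambda * D * energy f].  These two steps are
    [profile_level] and [capacity_admissible].

    Most of the work goes into the displayed inequality, because the Sobolev
    inequality is assumed for smooth functions and [u] is only locally Lipschitz.

    If [f] is Lipschitz ([sobolev_lip]), cut it strictly inside the two levels,
    with twice the slope, which uses up the factor [4].  Then [u] is constant near every point of the two level sets, and a
    mollification at a small scale keeps the plateaus [0] and [1] exactly.  The
    mollification is carried out in one coordinate after the other, so that only
    integrals over the line occur.  It commutes with partial derivatives; on
    almost every line it converges to the function mollified, by Lebesgue
    differentiation; and all partial derivatives are bounded by the Lipschitz
    constant.  So energies converge, by dominated convergence
    ([smooth_along_energy_cvg], [mollify_directions]).  What passes from lines to
    [R^n] is the fact that a set is Lebesgue-null if and only if almost all its
    slices in a coordinate direction are ([lebesgueRn_null_slices]); together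
    with the one-dimensional case it also gives the existence almost everywhere
    of partial derivatives of Lipschitz functions.

    If [f] is locally Lipschitz ([sobolev_locally_lipschitz]), take its positive
    part and cap it by a tent of height [2 s] that falls to [0] between the radii
    [r] and [2 r].  This is globally Lipschitz, and where it is not locally equal
    to [f] it touches either [0] or the tent, so that its partial derivatives are
    at most [2 s / r] there.  The energy is thus increased by
    [n * (2 s / r)^2] at most, which tends to [0] as [r] grows.

    For [D > 0] it remains to take the infimum over [f].  Otherwise [n = 0], where
    [A] has to be empty, or [D = 0]: a linear coordinate has energy [1], which
    excludes [D < 0].  When [D = 0] there may be no competitor for [A] at all, and
    one compares [A] with a half-space of the same measure, which does have
    competitors for slightly smaller half-spaces ([sobolev_constant_eq0]). *)

Set Implicit Arguments.
Unset Strict Implicit.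
Unset Printing Implicit Defensive.

Local Open Scope classical_set_scope.
Local Open Scope ring_scope.

(** * Coordinates and Borel sets *)

Section coordinates.
Context {R : realType} {n : nat}.
Implicit Types (x y : 'rV[R]_n) (i j : 'I_n) (s t : R).

Definition upd x i t : 'rV[R]_n := \row_j (if j == i then t else x 0 j).

Lemma updE x i t : upd x i t 0 i = t.
Proof. by rewrite mxE eqxx. Qed.

Lemma updNE x i j t : j != i -> upd x i t 0 j = x 0 j.
Proof. by rewrite mxE => /negbTE ->. Qed.

Lemma upd_id x i : upd x i (x 0 i) = x.
Proof. by apply/rowP => j; rewrite mxE; case: eqVneq => [->|]. Qed.

Lemma upd_upd x i s t : upd (upd x i s) i t = upd x i t.
Proof. by apply/rowP => j; rewrite !mxE; case: eqVneq. Qed.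

Lemma add_delta x i t : t *: delta_mx 0 i + x = upd x i (t + x 0 i).
Proof.
apply/rowP => j; rewrite !mxE eqxx /=.
by case: eqVneq => [->|_]; rewrite ?mulr1 ?mulr0 ?add0r.
Qed.

Lemma le_coord_norm x i : `|x 0 i| <= `|x|.
Proof.
rewrite [leRHS]/Num.norm /= mx_normrE.
by apply: (le_bigmax _ (fun k : 'I_1 * 'I_n => `|x k.1 k.2|) (0, i)).
Qed.

Lemma norm_rV_le x (c : R) : 0 <= c -> (forall i, `|x 0 i| <= c) -> `|x| <= c.
Proof.
move=> c0 xc; rewrite [leLHS]/Num.norm /= mx_normrE.
by apply/bigmax_leP; split => //= -[i j] _ /=; rewrite ord1; exact: xc.
Qed.

Lemma norm_updB x i s t : `|upd x i s - upd x i t| = `|s - t|.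
Proof.
apply/eqP; rewrite eq_le; apply/andP; split.
  apply: norm_rV_le => // j; rewrite !mxE.
  by case: eqVneq => // _; rewrite subrr normr0.
have := le_coord_norm (upd x i s - upd x i t) i.
by rewrite !mxE eqxx.
Qed.

End coordinates.

Section borel_coordinates.
Context {R : realType} {n : nat}.

Lemma measurable_open_rV (U : set 'rV[R]_n) : open U -> @measurable _ (borelRn R n) U.
Proof. by move=> oU; apply: sub_sigma_algebra. Qed.

Lemma continuous_measurable_rV (f : 'rV[R]_n -> R) : continuous f ->
  measurable_fun [set: borelRn R n] (f : borelRn R n -> R).
Proof.
move=> /continuousP cf; apply: (measurability _ (RGenOpens.measurableE R)).
move=> _ [_ [a [b ->] <-]]; rewrite setTI.
by apply: measurable_open_rV; apply: cf; exact: interval_open.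
Qed.

Lemma measurable_coord (i : 'I_n) :
  measurable_fun [set: borelRn R n] (fun x : borelRn R n => (x : 'rV[R]_n) 0 i).
Proof. by apply: continuous_measurable_rV; exact: coord_continuous. Qed.

(** Second countability in explicit form: it is what lets measurability into
    [borelRn] be tested on balls, hence on coordinates. *)
Lemma open_bigcup_rat_ball (U : set 'rV[R]_n) : open U ->
  U = \bigcup_(p in [set p : 'rV[rat]_n * nat |
        ball (map_mx ratr p.1 : 'rV[R]_n) p.2.+1%:R^-1 `<=` U])
      ball (map_mx ratr p.1 : 'rV[R]_n) p.2.+1%:R^-1.
Proof.
move=> oU; apply/seteqP; split=> [x Ux|x [p /= pU /pU//]].
have /nbhs_ballP[e /= e0 eU] : nbhs x U by apply: open_nbhs_nbhs.
have [k ke] : exists k : nat, k.+1%:R^-1 < e / 2.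
  have e2 : 0 < e / 2 by rewrite divr_gt0.
  exists (Num.truncn (e / 2)^-1).
  by rewrite invf_plt ?posrE // truncnS_gt.
have k0 : 0 < k.+1%:R^-1 :> R by rewrite invr_gt0.
have /choice[q qP] : forall j : 'I_n, exists q : rat, `|x 0 j - ratr q| < k.+1%:R^-1.
  move=> j; have /rat_in_itvoo[q] : x 0 j - k.+1%:R^-1 < x 0 j + k.+1%:R^-1.
    by rewrite ltrBlDr -addrA ltrDl addr_gt0.
  rewrite in_itv /= => /andP[q1 q2]; exists q.
  by rewrite ltr_distl ltrBlDr q2 -ltrBlDr q1.
have xq : ball (map_mx ratr (\row_j q j) : 'rV[R]_n) k.+1%:R^-1 x.
  by split=> // i j; rewrite !mxE ord1 -ball_normE /= distrC; exact: qP.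
exists (\row_j q j, k) => //= y yq; apply: eU.
move: yq xq; rewrite -!ball_normE /= => yq xq.
rewrite (le_lt_trans (ler_distD (map_mx ratr (\row_j q j)) x y)) //.
rewrite distrC in xq; apply: (lt_trans (ltrD xq yq)); by rewrite [ltRHS](splitr e) ltrD.
Qed.

(** The sigma-algebra of [borelRn] is generated by open sets, not by the
    coordinates; but a ball of the sup norm is a product of intervals, and every
    open set is a countable union of balls. *)
Lemma measurable_rV_coordP d (T : measurableType d) (g : T -> borelRn R n) :
  (forall i, measurable_fun setT (fun t => (g t : 'rV[R]_n) 0 i)) -> measurable_fun setT g.
Proof.
move=> mg; apply: (@measurability _ _ T (borelRn R n) setT g (@open 'rV[R]_n)) => // _ [U oU <-].
rewrite setTI (open_bigcup_rat_ball oU) preimage_bigcup.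
rewrite bigcup_mkcond; apply: countable_bigcupT_measurable => // p.
case: ifPn => // _.
have [->|/set0P[z pz]] := eqVneq
  (ball (map_mx ratr p.1 : 'rV[R]_n) p.2.+1%:R^-1 : set (borelRn R n)) set0.
  by rewrite preimage_set0.
have -> : g @^-1` (ball (map_mx ratr p.1 : 'rV[R]_n) p.2.+1%:R^-1) =
    \bigcap_(i in [set: 'I_n]) ((fun t => (g t : 'rV[R]_n) 0 i) @^-1`
      ball (ratr (p.1 0 i) : R) p.2.+1%:R^-1).
  apply/seteqP; split => t /=.
    by move=> [_ gt] i _ /=; have := gt 0 i; rewrite mxE.
  move=> gt; split => // i j; rewrite mxE ord1; exact: gt.
apply: fin_bigcap_measurable => // i _; rewrite -[X in measurable X]setTI.
by apply: mg => //; exact: measurable_ball.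
Qed.

Lemma continuous_measurable_rV2 d (T : measurableType d) (i : 'I_n) (g : T -> borelRn R n)
    (h : T -> R) : measurable_fun setT g -> measurable_fun setT h ->
  measurable_fun setT (fun t => upd (g t) i (h t) : borelRn R n).
Proof.
move=> mg mh; apply: measurable_rV_coordP => j.
under eq_fun do rewrite mxE.
have [_|ji] := eqVneq j i; first exact: mh.
exact: measurableT_comp (measurable_coord j) mg.
Qed.

End borel_coordinates.

(** * Lebesgue null sets and their one-dimensional slices *)

Section null_sets.
Local Open Scope ereal_scope.
Context d (T : measurableType d) (R : realType).
Variable mu : {measure set T -> \bar R}.

Lemma integral_ge0_null (f : T -> \bar R) : measurable_fun setT f ->
  (forall x, 0 <= f x) ->
  (\int[mu]_x f x = 0 <-> mu [set x | f x != 0] = 0).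
Proof.
move=> mf f0.
have mN : measurable [set x | f x != 0].
  by rewrite -[X in measurable X]setTI; exact: emeasurable_neq.
have -> : \int[mu]_x f x = \int[mu]_x `|f x|.
  by apply: eq_integral => x _; rewrite gee0_abs.
rewrite ae_eq_integral_abs //; split.
- move=> /= H; apply: (measure_negligible mN); apply: negligibleS H => x /= fx.
  by apply/not_implyP; split => //; apply/eqP.
- move=> H; exists [set x | f x != 0]; split => // x /= /not_implyP[_ fx].
  exact/eqP.
Qed.

End null_sets.

Section product_null.
Local Open Scope ereal_scope.
Context d1 d2 (T1 : measurableType d1) (T2 : measurableType d2) (R : realType).
Variable m1 : {sigma_finite_measure set T1 -> \bar R}.
Variable m2 : {sigma_finite_measure set T2 -> \bar R}.

Lemma product_null_xsection (B : set (T1 * T2)) : measurable B ->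
  ((m1 \x m2) B = 0 <-> m1 [set x | m2 (xsection B x) != 0] = 0).
Proof.
move=> mB; apply: integral_ge0_null; first exact: measurable_fun_xsection.
by move=> x; exact: measure_ge0.
Qed.

(** The product measure is defined through sections in one direction; its
    uniqueness identifies it with the integral in the other order. *)
Lemma product_null_ysection (B : set (T1 * T2)) : measurable B ->
  ((m1 \x m2) B = 0 <-> m2 [set y | m1 (ysection B y) != 0] = 0).
Proof.
move=> mB.
have -> : (m1 \x m2) B = (m1 \x^ m2) B.
  apply: product_measure_unique => // A1 A2 mA1 mA2.
  exact: product_measure2E.
apply: integral_ge0_null; first exact: measurable_fun_ysection.
by move=> x; exact: measure_ge0.
Qed.

End product_null.

Section sigma_finite_measure_of.
Context d (T : measurableType d) (R : realType) (m : {measure set T -> \bar R}).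
Hypothesis mfin : sigma_finite setT m.

(** An alias, so that a sigma-finiteness proof available only as a hypothesis
    can be registered as a structure. *)
Definition sigma_finite_copy : set T -> \bar R := m.
HB.instance Definition _ := Measure.on sigma_finite_copy.
HB.instance Definition _ :=
  Measure_isSigmaFinite.Build d T R sigma_finite_copy mfin.

Lemma sigma_finite_measure_of :
  exists m' : {sigma_finite_measure set T -> \bar R},
    (m : set T -> \bar R) = m'.
Proof. by exists sigma_finite_copy. Qed.

End sigma_finite_measure_of.

Section lebesgueRn_measure.
Context {R : realType}.
Notation lam := (@lebesgue_measure R).

(** The identification of [R * R^m] with [R^(m+1)] used by [lebesgueRn]. *)
Definition consRn m (p : measurableTypeR R * borelRn R m) : borelRn R m.+1 :=
  row_mx (p.1%:M : 'rV[R]_1) (p.2 : 'rV[R]_m).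
Definition unconsRn m (x : borelRn R m.+1) : measurableTypeR R * borelRn R m :=
  ((x : 'rV[R]_m.+1) 0 ord0, \row_j (x : 'rV[R]_m.+1) 0 (lift ord0 j)).

Lemma consRn0 m (p : measurableTypeR R * borelRn R m) : (consRn p : 'rV[R]_m.+1) 0 ord0 = p.1.
Proof.
rewrite /consRn; have -> : ord0 = lshift m (0 : 'I_1) by apply/val_inj.
by apply: etrans (row_mxEl _ _ _ _) _; rewrite mxE eqxx mulr1n.
Qed.

Lemma consRnS m (p : measurableTypeR R * borelRn R m) j :
  (consRn p : 'rV[R]_m.+1) 0 (lift ord0 j) = (p.2 : 'rV[R]_m) 0 j.
Proof.
rewrite /consRn; have -> : lift ord0 j = rshift 1 j by apply/val_inj.
exact: row_mxEr.
Qed.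

Lemma consRnK m : cancel (@consRn m) (@unconsRn m).
Proof.
move=> [a y]; rewrite /unconsRn; congr pair; first exact: consRn0.
by apply/rowP => j; rewrite mxE consRnS.
Qed.

Lemma measurable_consRn m : measurable_fun setT (@consRn m).
Proof.
apply: measurable_rV_coordP => i; case: (unliftP ord0 i) => [k|] ->.
  under eq_fun do rewrite consRnS.
  exact: measurableT_comp (measurable_coord k) measurable_snd.
by under eq_fun do rewrite consRn0; exact: measurable_fst.
Qed.

Lemma measurable_unconsRn m : measurable_fun setT (@unconsRn m).
Proof.
apply/measurable_fun_pairP; split; first exact: measurable_coord.
apply: measurable_rV_coordP => i.
by under eq_fun do rewrite /= mxE; exact: measurable_coord.
Qed.

Lemma upd_consRn0 m (p : measurableTypeR R * borelRn R m) t :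
  upd (consRn p) ord0 t = consRn (t, p.2).
Proof.
apply/rowP => j; rewrite mxE; case: (unliftP ord0 j) => [k|] ->.
  by rewrite !consRnS.
by rewrite eqxx consRn0.
Qed.

Lemma upd_consRnS m (p : measurableTypeR R * borelRn R m) (i : 'I_m) t :
  upd (consRn p) (lift ord0 i) t = consRn (p.1, upd p.2 i t).
Proof.
apply/rowP => j; rewrite mxE; case: (unliftP ord0 j) => [k|] ->.
  by rewrite !consRnS mxE (inj_eq lift_inj).
by rewrite !consRn0 eq_liftF.
Qed.

(** [lebesgueRn] is a bare set function.  Measure structure and
    sigma-finiteness are obtained together by induction, since the product
    measure of the next stage requires both. *)
Lemma lebesgueRn_measure n :
  exists m : {sigma_finite_measure set (borelRn R n) -> \bar R},
    @lebesgueRn R n = m.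
Proof.
elim: n => [|n [m mE]]; first by exists (dirac ((0 : 'rV[R]_0) : borelRn R 0)).
pose pm : {measure set _ -> \bar R} := (lam \x m)%E.
pose q := pushforward pm (@consRn n).
pose q1 := HB.pack_for {measure set (borelRn R n.+1) -> \bar R} q.
pose q2 := q1 (@measurable_consRn n).
have qfin : sigma_finite setT q2.
  have /sigma_finiteP[F [TF ndF Foo]] := sigma_finiteT lam.
  have /sigma_finiteP[G [TG ndG Goo]] := sigma_finiteT m.
  (* The two exhaustions are increasing, so their products cover the product. *)
  exists (fun k => @unconsRn n @^-1` (F k `*` G k)).
    apply/esym; rewrite -subTset => x _.
    have [k _ Fk] : (\bigcup_k F k) (unconsRn x).1 by rewrite -TF.
    have [l _ Gl] : (\bigcup_k G k) (unconsRn x).2 by rewrite -TG.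
    exists (maxn k l) => //; split.
      by move: Fk; exact/subsetPset/ndF/leq_maxl.
    by move: Gl; exact/subsetPset/ndG/leq_maxr.
  move=> k; have [mF Fk] := Foo k; have [mG Gk] := Goo k; split.
    rewrite -[X in measurable X]setTI; apply: measurable_unconsRn => //.
    exact: measurableX.
  rewrite /q2 /= /q /pushforward.
  rewrite (_ : _ @^-1` _ = F k `*` G k); last first.
    by apply/funext => p; rewrite /preimage /mkset consRnK.
  rewrite /pm /= product_measure1E // lte_mul_pinfty // ge0_fin_numE //.
have [m' m'E] := sigma_finite_measure_of qfin.
by exists m'; rewrite -m'E /= mE.
Qed.

Definition slice n (x : 'rV[R]_n) (i : 'I_n) (N : set (borelRn R n)) : set R :=
  [set t | N (upd x i t)].

Lemma measurable_slices n (N : set (borelRn R n)) (i : 'I_n) : measurable N ->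
  measurable_fun setT (fun x : borelRn R n => lam (slice x i N)).
Proof.
move=> mN.
have mU : measurable_fun setT
    (fun p : borelRn R n * measurableTypeR R => upd p.1 i (p.2 : R) : borelRn R n).
  apply: continuous_measurable_rV2; first exact: measurable_fst.
  exact: measurable_snd.
have mB : measurable ((fun p : borelRn R n * measurableTypeR R => upd p.1 i (p.2 : R) : borelRn R n) @^-1` N).
  by rewrite -[X in measurable X]setTI; exact: mU.
have := measurable_fun_xsection lam mB.
congr (measurable_fun _ _); apply/funext => x /=; congr (lam _).
by apply/seteqP; split => t; rewrite /xsection /= ?inE.
Qed.

(** The base points of the lines in direction [i] along which [N] is not
    null.  Fubini would integrate over the remaining [n - 1] coordinates; keeping
    all [n] coordinates avoids a second space: the set is invariant in direction
    [i], and each of its own slices is empty or full. *)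
Definition fat_slices n (i : 'I_n) (N : set (borelRn R n)) : set (borelRn R n) :=
  [set x | lam (slice x i N) != 0%E].

Lemma measurable_fat_slices n (N : set (borelRn R n)) (i : 'I_n) :
  measurable N -> measurable (fat_slices i N).
Proof.
move=> mN; rewrite -[X in measurable X]setTI.
by apply: emeasurable_neq => //; exact: measurable_slices.
Qed.

(** Fubini for null sets, in any direction.  By induction on the dimension: for
    the first coordinate the two sides are the sections of a product set in the
    second factor, and for a later coordinate one takes sections in the first
    factor and applies the induction hypothesis to them. *)
Lemma lebesgueRn_null_slices n (N : set (borelRn R n)) (i : 'I_n) : measurable N ->
  @lebesgueRn R n N = 0%E <->
  @lebesgueRn R n (fat_slices i N) = 0%E.
Proof.
elim: n N i => [|n IH] N i mN; first by case: i.
have mpre (A : set (borelRn R n.+1)) : measurable A -> measurable (@consRn n @^-1` A).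
  by move=> mA; rewrite -[X in measurable X]setTI; exact: measurable_consRn.
have [m mE] := lebesgueRn_measure n.
rewrite /= -/lebesgueRn mE /pushforward.
have [j ->|->] := unliftP ord0 i.
- pose B' : set (measurableTypeR R * borelRn R n) :=
    [set p | lam (slice p.2 j (xsection (@consRn n @^-1` N) p.1)) != 0%E].
  have BE : @consRn n @^-1` (fat_slices (lift ord0 j) N) = B'.
    suff E p : slice (consRn p) (lift ord0 j) N =
        slice p.2 j (xsection (@consRn n @^-1` N) p.1).
      by apply/funext => p; rewrite /B' /fat_slices /preimage /mkset E.
    by apply/seteqP; split => t; rewrite /slice /xsection /= inE /= upd_consRnS.
  have mB' : measurable B' by rewrite -BE; exact: mpre (measurable_fat_slices _ mN).
  rewrite BE.
  rewrite (product_null_xsection lam m (mpre _ mN)).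
  rewrite (product_null_xsection lam m mB').
  rewrite (_ : [set x | m (xsection B' x) != 0%E] =
    [set x | m (xsection (consRn (m:=n) @^-1` N) x) != 0%E]) //.
  apply/seteqP; split => x /=; apply: contra_neq; rewrite -mE.
    move/(IH _ j (measurable_xsection x (mpre _ mN))) => H.
    rewrite -[RHS]H; congr (lebesgueRn _).
    by apply/seteqP; split => y; rewrite /xsection /B' /= inE.
  move=> H; apply/(IH _ j (measurable_xsection x (mpre _ mN))).
  rewrite -[RHS]H; congr (lebesgueRn _).
  by apply/seteqP; split => y; rewrite /xsection /B' /= inE.
- rewrite (product_null_ysection lam m (mpre _ mN)).
  rewrite (product_null_ysection lam m (mpre _ (measurable_fat_slices _ mN))).
  set B := _ @^-1` N.
  rewrite (_ : [set y | lam (ysection (consRn (m:=n) @^-1` (fat_slices ord0 N)) y) != 0%E] =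
    [set y | lam (ysection B y) != 0%E]) //.
  have E (t : R) (y : borelRn R n) : slice (consRn (t, y)) ord0 N = ysection B y.
    by apply/seteqP; split => s; rewrite /slice /ysection /= inE /= upd_consRn0.
  apply/seteqP; split => y /=.
    apply: contra_neq => H.
    rewrite (_ : ysection _ _ = set0) ?measure0 //.
    apply/seteqP; split => t //; rewrite /ysection /= inE /= /fat_slices /= E H eqxx //.
  move=> H; rewrite (_ : ysection _ _ = setT).
    by rewrite -set_itvNyy lebesgue_measure_itv.
  by apply/seteqP; split => t //; rewrite /ysection /= inE /= /fat_slices /= E H.
Qed.

End lebesgueRn_measure.

(** * Differentiability almost everywhere of Lipschitz functions on the line *)

Section lipschitz_derivable.
Context {R : realType}.
Notation lam := (@lebesgue_measure R).

Section nonexpansive.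
Variable g : R -> R.
Hypothesis g_lip : forall x y, `|g x - g y| <= `|x - y|.

Lemma nonexpansive_continuous : continuous g.
Proof.
move=> x; apply/cvgrPdist_lt => e e0; near=> y.
by rewrite (le_lt_trans (g_lip x y)) //; near: y; exact: cvgr_dist_lt.
Unshelve. all: by end_near. Qed.

(** Two non-decreasing functions whose sum is the identity.  Their Stieltjes measures add up to Lebesgue measure, and each of them is
    therefore absolutely continuous. *)
Definition half_sum (b : bool) (x : R) : R := (x + (-1) ^+ b * g x) / 2.

Lemma half_sum_nd b : nondecreasing (half_sum b).
Proof.
move=> x y xy; rewrite /half_sum ler_pM2r // -subr_ge0.
have := g_lip y x; rewrite [leRHS]ger0_norm ?subr_ge0 // ler_norml => /andP[].
by case: b; rewrite ?expr1 ?expr0; lra.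
Qed.

Lemma half_sum_continuous b : continuous (half_sum b).
Proof.
move=> x; apply: cvgM; last exact: cvg_cst.
apply: cvgD; first exact: cvg_id.
by apply: cvgM; [exact: cvg_cst|exact: nonexpansive_continuous].
Qed.

HB.instance Definition _ b := isCumulative.Build R _ R (half_sum b)
  (@half_sum_nd b) (right_continuousW (@half_sum_continuous b)).

Let nu b : {measure set (measurableTypeR R) -> \bar R} :=
  lebesgue_stieltjes_measure (half_sum b).

Lemma stieltjes_oc b (x y : R) : x <= y ->
  nu b (`]x, y]%classic : set R) = (half_sum b y - half_sum b x)%:E.
Proof.
move=> xy; rewrite /nu /= /lebesgue_stieltjes_measure /measure_extension.
by rewrite measurable_mu_extE /= ?wlength_itv_bnd //; exact: is_ocitv.
Qed.

(** Both sides agree on half-open intervals, where the two increments of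
    [half_sum] add up to the length. *)
Lemma lebesgue_half_sum A : measurable A -> lam A = (nu false A + nu true A)%E.
Proof.
move=> mA; rewrite -measure_addE.
apply: lebesgue_stieltjes_measure_unique mA => _ [[x y] _ <-] /=.
transitivity (nu false (`]x, y]%classic : set R) + nu true (`]x, y]%classic : set R))%E;
  last exact/esym/measure_addE.
have [xy|yx] := leP x y; last by rewrite set_itv_ge ?bnd_simp -?leNgt ?ltW // !measure0 adde0.
have -> : lebesgue_stieltjes_measure idfun (`]x, y]%classic : set R) = (y - x)%:E.
  rewrite /lebesgue_stieltjes_measure /measure_extension.
  by rewrite measurable_mu_extE /= ?wlength_itv_bnd //; exact: is_ocitv.
rewrite !stieltjes_oc // -EFinD; congr EFin.
by rewrite /half_sum expr0 expr1; field.
Qed.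

Lemma stieltjes_dominated b : nu b `<< lam.
Proof.
apply/null_content_dominatesP => A mA.
change (lam A = 0%E -> nu b A = 0%E).
rewrite lebesgue_half_sum // => /eqP; rewrite padde_eq0 //.
by case: b => /andP[/eqP ? /eqP].
Qed.

(** Rademacher's theorem on the line.  The Stieltjes measure of [half_sum] has a
    density with respect to Lebesgue measure by Radon-Nikodym, [half_sum] is a
    primitive of the density, and primitives are derivable at Lebesgue points. *)
Lemma nonexpansive_ae_derivable :
  lam.-negligible [set x | ~ derivable g x 1].
Proof.
(* Radon-Nikodym is applied on a bounded window, where the measure is finite. *)
suff H k : lam.-negligible [set x | (x \in `](- k%:R), k%:R[) /\ ~ derivable g x 1].
  apply: negligibleS (negligible_bigcup H) => x /= nd.
  exists (Num.truncn `|x|).+1 => //=; split => //.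
  by rewrite in_itv /= -ltr_norml truncnS_gt.
pose D : set (measurableTypeR R) := `](- k%:R : R), k%:R]%classic.
have mD : measurable D by exact: measurable_itv.
have fD : (nu false D < +oo)%E.
  by rewrite stieltjes_oc ?ltry //; have := ler0n R k; lra.
pose nuk : {finite_measure set (measurableTypeR R) -> \bar R} := mfrestr mD fD.
have nukd : nuk `<< lam.
  apply/null_content_dominatesP => A mA A0; apply/eqP; rewrite -measure_le0.
  have /null_content_dominatesP := @stieltjes_dominated false.
  move=> /(_ A mA A0) <-; rewrite /nuk /= /mfrestr /mrestr.
  by apply: le_measure; rewrite ?inE //; exact: measurableI.
have [h [h0 hfin inth hE]] := radon_nikodym_sigma_finite nukd.
pose h' := fine \o h.
have hh' : h = EFin \o h' by apply/funext => x; rewrite /h' /= fineK.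
rewrite hh' in inth hE.
have lh : locally_integrable setT h' by apply: open_integrable_locally => //; exact: openT.
have inty (y : R) : lam.-integrable (`]-oo, y]%classic : set R) (EFin \o h').
  apply: (@integrableS _ _ _ lam setT) => //; exact: measurable_itv.
have := FTC1Ny inty lh.
rewrite /almost_everywhere /=; apply: negligibleS => x [xk] + H; apply.
have [+ _] := H.
set G := fun y => \int[_]_(t in _) _.
have GE y : y \in `](- k%:R), k%:R[ -> G y = half_sum false y - half_sum false (- k%:R).
  rewrite in_itv /= => /andP[ky yk].
  rewrite /G /Rintegral -hE; last exact: measurable_itv.
  rewrite /nuk /= /mfrestr /mrestr.
  rewrite (_ : _ `&` _ = `](- k%:R), y]%classic) ?stieltjes_oc ?ltW //.
  apply/seteqP; split => z /=; rewrite /D /= !in_itv /=; first by case=> ->/andP[->].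
  by move=> /andP[kz zy]; rewrite kz zy (le_trans zy (ltW yk)).
move=> dG.
have E : {near x, G =1 (fun y => half_sum false y - half_sum false (- k%:R))}.
  by near=> y; apply: GE; near: y; exact: near_in_itvoo.
have dF : derivable (fun y => half_sum false y - half_sum false (- k%:R)) x 1.
  by apply: near_eq_derivable E dG; rewrite oner_neq0.
(* [g] is recovered from [half_sum] as [2 * half_sum false y - y]. *)
have -> : g = (fun y => 2 *: ((half_sum false y - half_sum false (- k%:R)) + half_sum false (- k%:R)) - y).
  by apply/funext => y; rewrite subrK /half_sum expr0 /GRing.scale /=; field.
apply: derivableB => //; apply: derivableZ; apply: derivableD => //.
Unshelve. all: by end_near. Qed.

End nonexpansive.

Lemma lipschitz_ae_derivable (f : R -> R) (L : R) :
  (forall x y, `|f x - f y| <= L * `|x - y|) ->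
  lam.-negligible [set x | ~ derivable f x 1].
Proof.
move=> f_lip.
pose K := `|L| + 1.
have K0 : 0 < K by rewrite /K ltr_wpDl.
have gl x y : `|(fun x => K^-1 *: f x) x - (fun x => K^-1 *: f x) y| <= `|x - y|.
  rewrite -scalerBr normrZ gtr0_norm ?invr_gt0 // ler_pdivrMl //.
  apply: le_trans (f_lip x y) _; rewrite ler_wpM2r // /K.
  by rewrite (le_trans (ler_norm L)) // lerDl.
apply: negligibleS (nonexpansive_ae_derivable gl) => x /= nf dg; apply: nf.
have -> : f = (fun x => K *: (K^-1 *: f x)).
  by apply/funext => y; rewrite scalerA divff ?scale1r ?gt_eqF.
exact: derivableZ.
Qed.

End lipschitz_derivable.

(** * Partial derivatives of continuous and of Lipschitz functions *)

Section continuous_algebra.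
Context {R : realType} {V : topologicalType}.
Implicit Types f g : V -> R.

Lemma continuous_funM f g : continuous f -> continuous g ->
  continuous (fun x => f x * g x).
Proof. by move=> cf cg x; apply: cvgM; [exact: cf|exact: cg]. Qed.

Lemma continuous_funD f g : continuous f -> continuous g ->
  continuous (fun x => f x + g x).
Proof. by move=> cf cg x; apply: cvgD; [exact: cf|exact: cg]. Qed.

Lemma continuous_funB f g : continuous f -> continuous g ->
  continuous (fun x => f x - g x).
Proof. by move=> cf cg x; apply: cvgB; [exact: cf|exact: cg]. Qed.

Lemma continuous_cst (c : R) : continuous (fun _ : V => c).
Proof. by move=> x; exact: cvg_cst. Qed.

Lemma continuous_funnorm f : continuous f -> continuous (fun x => `|f x|).
Proof. by move=> cf x; apply: cvg_norm; exact: cf. Qed.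

End continuous_algebra.

Lemma continuous_normP (R : realType) (U V : normedModType R) (g : U -> V) :
  continuous g <-> forall x e, 0 < e -> exists2 r, 0 < r &
    forall y, `|x - y| < r -> `|g x - g y| < e.
Proof.
split=> [cg x e e0|H x].
  have /cvgrPdist_lt/(_ e e0)/nbhs_ballP[r /= r0 Hr] := cg x.
  by exists r => // y xy; apply: Hr; rewrite -ball_normE.
apply/cvgrPdist_lt => e e0; have [r r0 Hr] := H x e e0.
by apply/nbhs_ballP; exists r => //= y; rewrite -ball_normE /= => /Hr.
Qed.

Section partial_derivatives.
Context {R : realType} {n : nat}.
Notation lam := (@lebesgue_measure R).
Notation delta i := (delta_mx 0 i : 'rV[R]_n).
Implicit Types (f : 'rV[R]_n -> R) (i : 'I_n) (x y : 'rV[R]_n).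

(** The difference quotient behind ['D_(delta_mx 0 i) f x], written with [upd]
    so that it only sees the line through [x] in direction [i]. *)
Definition dquot f i (h : R) x : R := h^-1 * (f (upd x i (h + x 0 i)) - f x).

Lemma derivable_dquot f i x :
  derivable f x (delta i) <-> cvg (dquot f i h x @[h --> 0^']).
Proof.
rewrite /derivable (_ : (fun h => _) = (fun h => dquot f i h x)) //.
by apply/funext => h; rewrite /= add_delta.
Qed.

Lemma derive_dquot f i x : 'D_(delta i) f x = lim (dquot f i h x @[h --> 0^']).
Proof.
rewrite /derive (_ : (fun h => _) = (fun h => dquot f i h x)) //.
by apply/funext => h; rewrite /= add_delta.
Qed.

Lemma derivable_upd f i x :
  derivable f x (delta i) <-> derivable (fun t => f (upd x i t)) (x 0 i) 1.
Proof.
rewrite derivable_dquot /derivable (_ : (fun h => _ *: _) = (fun h => dquot f i h x)) //.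
by apply/funext => h; rewrite /= upd_id [h *: 1]mulr1.
Qed.

Lemma derive_upd f i x :
  'D_(delta i) f x = 'D_1 (fun t => f (upd x i t)) (x 0 i).
Proof.
rewrite derive_dquot /derive (_ : (fun h => _ *: _) = (fun h => dquot f i h x)) //.
by apply/funext => h; rewrite /= upd_id [h *: 1]mulr1.
Qed.

(** A limit that does not exist is the default point, [0] in [R]; this makes
    partial derivatives measurable and bounded everywhere, not only almost
    everywhere. *)
Lemma partialRn_dvg f i x : ~ derivable f x (delta i) -> partialRn i f x = 0.
Proof.
rewrite derivable_dquot /partialRn derive_dquot => nd.
rewrite /lim /lim_in getPN // => l fl; apply: nd.
by apply/cvg_ex; exists l.
Qed.

Lemma partialRn_cvg f i x : derivable f x (delta i) ->
  dquot f i h x @[h --> 0^'] --> partialRn i f x.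
Proof. by rewrite derivable_dquot /partialRn derive_dquot. Qed.

Lemma continuous_upd_add i (t : R) : continuous (fun x => upd x i (t + x 0 i)).
Proof.
apply/continuous_normP => x e e0; exists e => // y.
by rewrite -!add_delta opprD addrACA subrr add0r.
Qed.

Lemma continuous_dquot f i h : continuous f -> continuous (dquot f i h).
Proof.
move=> cf; apply: continuous_funM; first exact: continuous_cst.
apply: continuous_funB => // x.
exact: (continuous_comp (@continuous_upd_add i h x) (cf _)).
Qed.

Definition nonderivable f i : set (borelRn R n) :=
  [set x : 'rV[R]_n | ~ derivable f x (delta i)].

Lemma closed_measurable_rV (A : set 'rV[R]_n) :
  closed A -> @measurable _ (borelRn R n) A.
Proof.
move=> cA; rewrite -[A]setCK; apply: measurableC.
by apply: measurable_open_rV; exact: closed_openC.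
Qed.

(** The Cauchy criterion for the difference quotients, with precision and
    radius from countable sets. *)
Definition dquot_cauchy f i (k m : nat) : set 'rV[R]_n :=
  [set x | forall h h', h != 0 -> h' != 0 -> `|h| <= m.+1%:R^-1 -> `|h'| <= m.+1%:R^-1 ->
    `|dquot f i h x - dquot f i h' x| <= k.+1%:R^-1].

(** An intersection over uncountably many increments, each condition being
    closed in [x]; this is why continuity of [f] suffices for measurability. *)
Lemma closed_dquot_cauchy f i k m : continuous f -> closed (dquot_cauchy f i k m).
Proof.
move=> cf.
have -> : dquot_cauchy f i k m = \bigcap_(p in [set p : R * R |
     [/\ p.1 != 0, p.2 != 0, `|p.1| <= m.+1%:R^-1 & `|p.2| <= m.+1%:R^-1]])
   ((fun x => `|dquot f i p.1 x - dquot f i p.2 x|) @^-1` [set y | y <= k.+1%:R^-1]).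
  apply/seteqP; split=> x H; first by move=> [h h'] /= []; exact: H.
  by move=> h h' h0 h'0 hm hm'; apply: (H (h, h')).
apply: closed_bigI => -[h h'] _; apply: closed_comp; last exact: closed_le.
move=> x _; apply: (continuous_funnorm (continuous_funB _ _));
  exact: continuous_dquot.
Qed.

Lemma derivable_cauchyE f i : ~` nonderivable f i =
  \bigcap_k \bigcup_m (dquot_cauchy f i k m : set (borelRn R n)).
Proof.
apply/seteqP; split => x.
  move=> /contrapT /derivable_dquot dx k _.
  have : 0 < k.+1%:R^-1 / 2 :> R by rewrite divr_gt0.
  move/cvgrPdist_le : dx => /[apply] -[e /= e0 H].
  have [m me] : exists m : nat, m.+1%:R^-1 < e.
    by exists (Num.truncn e^-1); rewrite invf_plt ?posrE // truncnS_gt.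
  exists m => // h h' h0 h'0 hm hm'.
  have := H h; rewrite /= sub0r normrN => /(_ (le_lt_trans hm me) h0) H1.
  have := H h'; rewrite /= sub0r normrN => /(_ (le_lt_trans hm' me) h'0) H2.
  rewrite (le_trans (ler_distD (lim (dquot f i h x @[h --> 0^'])) _ _)) //.
  by rewrite [leRHS]splitr lerD // distrC.
move=> H /=; apply; apply/derivable_dquot.
apply/cauchy_cvgP/cauchyP => e e0.
have [k ke] : exists k : nat, k.+1%:R^-1 < e.
  by exists (Num.truncn e^-1); rewrite invf_plt ?posrE // truncnS_gt.
have [m _ Hm] := H k I.
have m0 : 0 < m.+1%:R^-1 :> R by rewrite invr_gt0.
exists (dquot f i m.+1%:R^-1 x); exists m.+1%:R^-1 => //= h.
rewrite /ball_ /= sub0r normrN => hm h0; rewrite -ball_normE /=.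
apply: le_lt_trans ke; apply: Hm => //; last exact: ltW.
by rewrite gtr0_norm.
Qed.

Lemma measurable_nonderivable f i : continuous f -> measurable (nonderivable f i).
Proof.
move=> cf; rewrite -[nonderivable f i]setCK derivable_cauchyE.
apply: measurableC; apply: bigcapT_measurable => k.
apply: bigcupT_measurable => m.
by apply: closed_measurable_rV; exact: closed_dquot_cauchy.
Qed.

Lemma measurable_partialRn f i : continuous f ->
  measurable_fun setT (partialRn i f : borelRn R n -> R).
Proof.
move=> cf; have mN := measurable_nonderivable i cf.
rewrite -[setT](setvU (nonderivable f i)); apply/measurable_funU => //.
  exact: measurableC.
split.
- apply: (@measurable_fun_cvg _ _ R _ (fun k => dquot f i k.+1%:R^-1 : borelRn R n -> R)).
    move=> k; apply: measurable_funTS.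
    by apply: continuous_measurable_rV; exact: continuous_dquot.
  move=> x /contrapT dx.
  have /cvgr_dnbhsP := partialRn_cvg dx; apply; split.
    by move=> k; rewrite invr_eq0.
  exact: cvg_harmonic.
- apply: (eq_measurable_fun (cst 0 : borelRn R n -> R)); last exact: measurable_cst.
  by move=> x; rewrite inE => /partialRn_dvg ->.
Qed.

Lemma measurable_sqnorm_grad f : continuous f ->
  measurable_fun setT (fun x : borelRn R n => (sqnorm (grad f x))%:E).
Proof.
move=> cf; apply/measurable_EFinP; rewrite /sqnorm.
apply: measurable_sum => i.
under eq_fun do rewrite /grad mxE.
by apply: measurable_funX; exact: measurable_partialRn.
Qed.

Lemma sqnorm_ge0 (v : 'rV[R]_n) : 0 <= sqnorm v.
Proof. by apply: sumr_ge0 => i _; exact: sqr_ge0. Qed.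

(** The library notion of a Lipschitz map leaves the constant implicit; here
    the constant has to be followed through smoothing and truncation. *)
Definition lip f (L : R) := forall x y, `|f x - f y| <= L * `|x - y|.

Lemma lip_continuous f L : lip f L -> continuous f.
Proof.
move=> fL; apply/continuous_normP => x e e0.
have K0 : 0 < `|L| + 1 by rewrite ltr_wpDl.
exists (e / (`|L| + 1)) => [|y xy]; first by rewrite divr_gt0.
rewrite (le_lt_trans (fL x y)) //.
rewrite (@le_lt_trans _ _ ((`|L| + 1) * `|x - y|)) //.
  by rewrite ler_wpM2r // (le_trans (ler_norm L)) // lerDl.
by rewrite mulrC -ltr_pdivlMr.
Qed.

Lemma lip_dquot_le f L i h x : lip f L -> h != 0 -> `|dquot f i h x| <= L.
Proof.
move=> fL h0; rewrite /dquot normrM normfV ler_pdivrMl ?normr_gt0 //.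
rewrite -[X in f _ - f X](upd_id x i) (le_trans (fL _ _)) // norm_updB addrK.
by rewrite mulrC.
Qed.

Lemma lip_partialRn_le f L i x : 0 <= L -> lip f L -> `|partialRn i f x| <= L.
Proof.
move=> L0 fL; have [dx|ndx] := pselect (derivable f x (delta i)); last first.
  by rewrite partialRn_dvg // normr0.
rewrite leNgt; apply/negP => Ld.
have H : \forall h \near (0 : R)^', L < `|dquot f i h x|.
  by apply: cvgr_gt Ld; exact: cvg_norm (partialRn_cvg dx).
near (0 : R)^' => h.
have : L < `|dquot f i h x| by near: h.
rewrite ltNge lip_dquot_le //.
by near: h; exact: nbhs_dnbhs_neq.
Unshelve. all: by end_near. Qed.

(** Along each line the restriction is Lipschitz, so that every slice of the
    exceptional set is null; conclude with [lebesgueRn_null_slices]. *)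
Lemma lip_nonderivable_null f L i : lip f L ->
  @lebesgueRn R n (nonderivable f i) = 0%E.
Proof.
move=> fL; have cf := lip_continuous fL.
have mN := measurable_nonderivable i cf.
apply/(lebesgueRn_null_slices i mN).
have [m ->] := @lebesgueRn_measure R n.
rewrite (_ : fat_slices _ _ = set0) ?measure0 //.
apply/seteqP; split => x //=; rewrite /fat_slices /=.
apply/negP; rewrite negbK; apply/eqP; apply: measure_negligible.
  rewrite -[X in measurable X]setTI.
  have mu : measurable_fun setT (fun t : measurableTypeR R => upd x i (t : R) : borelRn R n).
    by apply: continuous_measurable_rV2 => //; exact: measurable_cst.
  exact: mu.
have lipu s t : `|f (upd x i s) - f (upd x i t)| <= L * `|s - t|.
  by rewrite (le_trans (fL _ _)) // norm_updB.
apply: negligibleS (lipschitz_ae_derivable lipu) => t.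
rewrite /slice /nonderivable /= => + dt; apply; apply/derivable_upd.
rewrite updE (_ : (fun s => _) = (fun s => f (upd x i s))) //.
by apply/funext => s; rewrite upd_upd.
Qed.

End partial_derivatives.

(** * A smooth bump function on the line *)

Section Ck.
Context {R : realType}.
Implicit Types (f g : R -> R) (k m : nat).

Fixpoint Ck k f : Prop :=
  match k with
  | 0%N => continuous f
  | k'.+1 => (forall x, derivable f x 1) /\ Ck k' (derive1 f)
  end.

Lemma derivable_fun_continuous f : (forall x, derivable f x 1) -> continuous f.
Proof. by move=> df x; exact/differentiable_continuous/derivable1_diffP. Qed.

Lemma Ck_pred k f : Ck k.+1 f -> Ck k f.
Proof.
elim: k f => [|k IH] f /=; first by case=> df _; exact: derivable_fun_continuous.
by move=> [df Cf]; split => //; exact: IH.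
Qed.

Lemma CkD k f g : Ck k f -> Ck k g -> Ck k (fun x => f x + g x).
Proof.
elim: k f g => [|k IH] f g /=; first by move=> cf cg; exact: continuous_funD.
move=> [df Cf] [dg Cg]; split; first by move=> x; exact: derivableD.
rewrite (_ : derive1 _ = (fun x => derive1 f x + derive1 g x)); first exact: IH.
by apply/funext => x; rewrite !derive1E deriveD.
Qed.

Lemma CkM k f g : Ck k f -> Ck k g -> Ck k (fun x => f x * g x).
Proof.
elim: k f g => [|k IH] f g; first by move=> cf cg; exact: continuous_funM.
move=> Cf Cg; have Cf' := Ck_pred Cf; have Cg' := Ck_pred Cg.
move: Cf Cg => /= [df Cf] [dg Cg]; split; first by move=> x; exact: derivableM.
rewrite (_ : derive1 _ = (fun x => f x * derive1 g x + g x * derive1 f x)).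
  by apply: CkD; exact: IH.
by apply/funext => x; rewrite !derive1E deriveM.
Qed.

Lemma Ck_cst k (c : R) : Ck k (fun=> c).
Proof.
elim: k c => [|k IH] c /=; first exact: continuous_cst.
split; first by move=> x; exact: derivable_cst.
rewrite (_ : derive1 _ = (fun=> 0)); first exact: IH.
by apply/funext => x; rewrite derive1E derive_cst.
Qed.

Lemma is_derive_cvg (f : R -> R) x d :
  h^-1 * (f (h + x) - f x) @[h --> 0^'] --> d -> is_derive x 1 f d.
Proof.
move=> H.
have E : (fun h : R => h^-1 *: ((f \o shift x) (h *: 1) - f x)) =
    (fun h : R => h^-1 * (f (h + x) - f x)).
  by apply/funext => h; rewrite /= [h *: 1]mulr1.
split; first by rewrite /derivable E; apply/cvg_ex; exists d.
by rewrite /derive E; exact: cvg_lim H.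
Qed.

Lemma Ck_affine k f (a b : R) : Ck k f -> Ck k (fun x => f (a * x + b)).
Proof.
elim: k f => [|k IH] f /=.
  move=> cf x; apply: (@continuous_comp _ _ _ (fun x => a * x + b) f); last exact: cf.
  apply: continuous_funD; last exact: continuous_cst.
  by apply: continuous_funM => // y; [exact: cvg_cst|exact: cvg_id].
move=> [df Cf].
have D (x : R) : is_derive x 1 (fun x => f (a * x + b)) (a * derive1 f (a * x + b)).
  have d1 : is_derive x 1 (fun x => a * x + b) a.
    apply: is_derive_cvg; apply: cvg_near_cst; near=> h.
    have h0 : h != 0 by near: h; exact: nbhs_dnbhs_neq.
    by field.
  have d2 : is_derive (a * x + b) 1 f (derive1 f (a * x + b)).
    by rewrite derive1E; exact: derivableP.
  by have := is_derive1_comp (f := f) (g := fun y => a * y + b) d2 d1; rewrite mulrC.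
split; first by move=> x; have [] := D x.
rewrite (_ : derive1 _ = (fun x => a * derive1 f (a * x + b))).
  by apply: CkM; [exact: Ck_cst|exact: IH].
by apply/funext => x; rewrite derive1E; have [_ ->] := D x.
Unshelve. all: by end_near. Qed.

End Ck.

Section flat_exponential.
Context {R : realType}.
Implicit Types (k m : nat) (x : R).

(** The function [x^-k * exp (-1/x)], extended by [0].  The powers of [1/x] are
    part of the definition because the family is then closed under derivation up
    to linear combinations, which yields smoothness by induction. *)
Definition flatexp k x : R := if 0 < x then x^-1 ^+ k * expR (- x^-1) else 0.

Lemma flatexp_ge0 k x : 0 <= flatexp k x.
Proof.
rewrite /flatexp; case: ifPn => // x0.
by rewrite mulr_ge0 ?expR_ge0 // exprn_ge0 // invr_ge0 ltW.
Qed.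

(** From [1 + y <= exp y] at [y = 1/(x * (k+1))], raised to the power [k+1].
    The bound by a multiple of [x] is all that derivability at [0] requires,
    since division by [x] just raises the index [k]. *)
Lemma flatexp_le k x : 0 <= x -> flatexp k x <= k.+1%:R ^+ k.+1 * x.
Proof.
rewrite /flatexp; case: ifPn => [x0 _|_ x0]; last by rewrite mulr_ge0 ?exprn_ge0.
have H : (x^-1 / k.+1%:R) ^+ k.+1 <= expR (x^-1).
  have -> : expR x^-1 = expR (x^-1 / k.+1%:R) ^+ k.+1.
    by rewrite -expRM_natl mulrCA divff ?mulr1 // pnatr_eq0.
  rewrite lerXn2r ?nnegrE ?expR_ge0 //; first by rewrite divr_ge0 ?invr_ge0 ?ltW.
  by rewrite (le_trans _ (expR_ge1Dx _)) // lerDr.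
rewrite expRN ler_pdivrMr ?expR_gt0 //.
have -> : x^-1 ^+ k = k.+1%:R ^+ k.+1 * x * (x^-1 / k.+1%:R) ^+ k.+1.
  rewrite exprMn [x^-1 ^+ k.+1]exprS.
  have xx : x * x^-1 = 1 by rewrite divff ?gt_eqF.
  have kk : (k.+1%:R : R) ^+ k.+1 * (k.+1%:R^-1) ^+ k.+1 = 1.
    by rewrite -exprMn divff ?expr1n // pnatr_eq0.
  move: kk; set c := k.+1%:R : R => kk.
  transitivity ((c ^+ k.+1 * c^-1 ^+ k.+1) * (x * x^-1) * x^-1 ^+ k).
    by rewrite kk xx !mul1r.
  ring.
by rewrite ler_wpM2l // mulr_ge0 ?exprn_ge0 // ltW.
Qed.

Lemma is_derive_flatexp k x :
  is_derive x 1 (flatexp k) (flatexp k.+2 x - k%:R * flatexp k.+1 x).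
Proof.
have [x0|x0|->] := ltgtP x 0.
- have E : \near x, 0 = flatexp k x.
    near=> y; rewrite /flatexp ltNge ifN // negbK ltW //.
    by near: y; exact: lt_nbhsl.
  apply: (near_eq_is_derive E).
  by rewrite /flatexp ltNge (ltW x0) /= mulr0 subrr; exact: is_derive_cst.
- have E : \near x, x^-1 ^+ k * expR (- x^-1) = flatexp k x.
    near=> y; rewrite /flatexp ifT //.
    by near: y; exact: lt_nbhsr.
  apply: (near_eq_is_derive E).
  have xn0 : x != 0 by rewrite gt_eqF.
  rewrite /flatexp x0.
  have d1 : is_derive x 1 (fun y : R => y^-1) (- x ^- 2).
    have := is_deriveV (f := id) xn0 (is_derive_id x 1).
    by rewrite /GRing.scale /= mulr1.
  have dX : is_derive x 1 (fun y : R => y^-1 ^+ k) ((k%:R * x^-1 ^+ k.-1) *: - x ^- 2).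
    have := is_deriveX k d1; rewrite (_ : _ ^+ k = (fun y : R => y^-1 ^+ k)) //.
    by apply/funext => y; elim: (k) => [//|m IHm]; rewrite !exprS /= -IHm.
  have dN := is_deriveN d1.
  have dE := is_derive1_comp (f := expR) (g := fun y => - y^-1) (is_derive_expR (- x^-1)) dN.
  have dM := is_deriveM dX dE.
  apply: (@is_derive_eq _ _ _ _ _ _ _ _ dM).
  rewrite /GRing.scale /= opprK -exprVn.
  case: k {E dX dM} => [|k] /=; rewrite ?fctE /= ?expr0 ?exprS; ring.
- rewrite {2 3}/flatexp ltxx mulr0 subrr.
  apply: is_derive_cvg; rewrite [flatexp k 0]/flatexp ltxx.
  pose C : R := k.+2%:R ^+ k.+2.
  have C0 : 0 < C by rewrite exprn_gt0.
  apply/cvgr0Pnorm_le => e e0.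
  near=> h; rewrite addr0 subr0.
  have h0 : h != 0 by near: h; exact: nbhs_dnbhs_neq.
  have [hn|hp|/eqP] := ltgtP h 0; last by rewrite (negbTE h0).
    by rewrite /flatexp ltNge (ltW hn) /= mulr0 normr0 ltW.
  have -> : h^-1 * flatexp k h = flatexp k.+1 h.
    by rewrite /flatexp hp mulrA -exprS.
  rewrite ger0_norm ?flatexp_ge0 // (le_trans (flatexp_le k.+1 (ltW hp))) //.
  rewrite -/C -ler_pdivlMl // -(gtr0_norm hp) mulrC.
  by near: h; apply: dnbhs0_le; rewrite divr_gt0.
Unshelve. all: by end_near. Qed.

Lemma Ck_flatexp m k : Ck m (flatexp k).
Proof.
elim: m k => [|m IH] k /=.
  by apply: derivable_fun_continuous => x; have [] := is_derive_flatexp k x.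
split; first by move=> x; have [] := is_derive_flatexp k x.
rewrite (_ : derive1 _ = fun x => flatexp k.+2 x + (- k%:R) * flatexp k.+1 x).
  by apply: CkD; [exact: IH|apply: CkM; [exact: Ck_cst|exact: IH]].
by apply/funext => x; rewrite derive1E mulNr; have [_ ->] := is_derive_flatexp k x.
Qed.

Lemma flatexp0_le1 x : flatexp 0 x <= 1.
Proof.
rewrite /flatexp; case: ifPn => // x0.
by rewrite expr0 mul1r expR_le1 oppr_le0 invr_ge0 ltW.
Qed.

Lemma flatexp0_half x : 2^-1 <= x -> expR (-2) <= flatexp 0 x.
Proof.
move=> x2; have x0 : 0 < x by rewrite (lt_le_trans _ x2).
rewrite /flatexp x0 expr0 mul1r ler_expR lerN2 -[leRHS]invrK.
by rewrite lef_pV2 ?posrE.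
Qed.

Lemma flatexp_eq0 k x : x <= 0 -> flatexp k x = 0.
Proof. by rewrite /flatexp ltNge => ->. Qed.

Definition bump x := flatexp 0 (1 * x + 1) * flatexp 0 (-1 * x + 1).

Lemma Ck_bump m : Ck m bump.
Proof. by apply: CkM; apply: Ck_affine; exact: Ck_flatexp. Qed.

Lemma bump_ge0 x : 0 <= bump x.
Proof. by rewrite mulr_ge0 ?flatexp_ge0. Qed.

Lemma bump_le1 x : bump x <= 1.
Proof. by rewrite mulr_ile1 ?flatexp_ge0 ?flatexp0_le1. Qed.

Lemma bump_support x : 1 <= `|x| -> bump x = 0.
Proof.
rewrite ler_normr /bump => /orP[x1|x1].
  by rewrite [X in _ * X]flatexp_eq0 ?mulr0 //; lra.
by rewrite flatexp_eq0 ?mul0r //; lra.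
Qed.

(** A lower bound on half of the support keeps the mass of a rescaled bump
    comparable to its width; see [mollifier_exists]. *)
Lemma bump_half x : `|x| <= 2^-1 -> expR (-4) <= bump x.
Proof.
rewrite ler_norml => /andP[x1 x2].
have -> : expR (-4) = expR (-2) * expR (-2) :> R by rewrite -expRD; congr expR; lra.
by rewrite ler_pM ?expR_ge0 // flatexp0_half //; lra.
Qed.

End flat_exponential.

(** * Convolution on the line *)

Section kernels.
Context {R : realType}.
Notation lam := (@lebesgue_measure R).
Implicit Types (e s t : R) (psi g : R -> R).

(** Smooth functions supported in an interval.  No sign or mass is imposed, so
    that derivatives of kernels are kernels. *)
Definition kern e psi : Prop :=
  (forall k, Ck k psi) /\ (forall t, e < `|t| -> psi t = 0).

Lemma kern_continuous e psi : kern e psi -> continuous psi.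
Proof. by move=> [/(_ 0%N)]. Qed.

Lemma kern_derivable e psi t : kern e psi -> derivable psi t 1.
Proof. by move=> [/(_ 1%N) [+ _] _]; apply. Qed.

Lemma kern_derive e psi : kern e psi -> kern e (derive1 psi).
Proof.
move=> [Cpsi psi0]; split; first by move=> k; have [] := Cpsi k.+1.
move=> t et; rewrite derive1E -(derive_cst (0 : R) t (1 : R)).
apply: near_eq_derive; near=> s; apply: psi0.
by near: s; apply: (cvgr_gt `|t|) => //; exact: norm_continuous.
Unshelve. all: by end_near. Qed.

Lemma kern_bounded e psi : 0 <= e -> kern e psi ->
  exists2 M, 0 <= M & forall t, `|psi t| <= M.
Proof.
move=> e0 kp; have cpsi := kern_continuous kp; have [_ psi0] := kp.
have cn : {within `[- e, e], continuous (fun t => `|psi t|)}.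
  by apply: continuous_subspaceT; exact: continuous_funnorm.
have ee : - e <= e by rewrite (le_trans _ e0) // oppr_le0.
have [c _ cM] := EVT_max ee cn.
exists `|psi c| => // t; have [te|et] := leP `|t| e.
  by apply: cM; rewrite in_itv /= -ler_norml.
by rewrite psi0 // normr0.
Qed.

Lemma integrable_compact_support g (K a b : R) : measurable_fun setT g ->
  (forall t, `|g t| <= K) -> (forall t, t \notin `[a, b] -> g t = 0) ->
  lam.-integrable setT (EFin \o g).
Proof.
move=> mg gK g0.
have iI := integrable_indic_itv a b true false.
have iK : lam.-integrable setT (fun t => (K%:E * ((\1_`[a, b]) t)%:E)%E).
  exact: integrableZl.
apply: le_integrable iK => //; first exact/measurable_EFinP.
move=> t _; rewrite /= lee_fin indicE.
have [tab|tab] := boolP (t \in `[a, b]).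
  by rewrite mem_set //= mulr1 (le_trans (gK t)) // ler_norm.
by rewrite g0 // normr0.
Qed.

(** By uniqueness, as the reflected measure agrees with Lebesgue measure on
    intervals. *)
Lemma lebesgue_reflect (s : R) (A : set (measurableTypeR R)) : measurable A ->
  lam [set t | A (s - t)] = lam A.
Proof.
move=> mA.
have mphi : measurable_fun setT ((fun t => s - t) : measurableTypeR R -> measurableTypeR R).
  apply: continuous_measurable_fun; apply: continuous_funB; first exact: continuous_cst.
  by move=> t; exact: cvg_id.
pose q1 := HB.pack_for {measure set (measurableTypeR R) -> \bar R}
  (pushforward lam ((fun t => s - t) : measurableTypeR R -> measurableTypeR R)).
have := @lebesgue_measure_unique R (q1 mphi).
move=> /(_ _ A mA) -> // _ [[a b] _ <-] /=.
rewrite /pushforward (_ : _ @^-1` _ = `[s - b, s - a[%classic); last first.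
  by apply/seteqP; split => t /=; rewrite !in_itv /= => /andP[? ?]; apply/andP; split; lra.
rewrite !lebesgue_measure_itv /= !lte_fin ltrD2l ltrN2.
by case: ifPn => // _; rewrite -!EFinB; congr EFin; lra.
Qed.

Lemma Rintegral_reflect (s : R) (h : R -> R) : measurable_fun setT h ->
  lam.-integrable setT (EFin \o (fun t => h (s - t))) ->
  \int[lam]_t h (s - t) = \int[lam]_t h t.
Proof.
move=> mh ih.
have mphi : measurable_fun setT ((fun t => s - t) : measurableTypeR R -> measurableTypeR R).
  apply: continuous_measurable_fun; apply: continuous_funB; first exact: continuous_cst.
  by move=> t; exact: cvg_id.
have := @integral_pushforward _ _ (measurableTypeR R) (measurableTypeR R) R _ mphi lam setT (EFin \o h).
rewrite preimage_setT => /(_ _ ih measurableT) H.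
rewrite /Rintegral -[in LHS]H; last exact/measurable_EFinP.
congr fine; pose q1 := HB.pack_for {measure set (measurableTypeR R) -> \bar R}
  (pushforward lam ((fun t => s - t) : measurableTypeR R -> measurableTypeR R)).
apply: (eq_measure_integral lam (m1 := q1 mphi)) => A mA _.
exact: lebesgue_reflect.
Qed.

(** The kernel carries the shift, so that differentiation in [s] falls on [psi]
    and the convolution is smooth for every bounded measurable [g]. *)
Definition conv psi g s : R := \int[lam]_t (g t * psi (s - t)).

Section conv_kernel.
Variables (e : R) (psi : R -> R) (e0 : 0 <= e) (kp : kern e psi).
Variables (g : R -> R) (K : R) (mg : measurable_fun setT g)
  (gK : forall t, `|g t| <= K).

Lemma continuous_reflect s : continuous (fun t => psi (s - t)).
Proof.
move=> t; apply: (@continuous_comp _ _ _ (fun t => s - t) psi); last exact: kern_continuous kp _.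
by apply: continuous_funB => u; [exact: cvg_cst|exact: cvg_id].
Qed.

Lemma kern_mul_integrable s :
  lam.-integrable setT (EFin \o (fun t => g t * psi (s - t))).
Proof.
have [M M0 pM] := kern_bounded e0 kp.
apply: (@integrable_compact_support _ (K * M) (s - e) (s + e)).
- by apply: measurable_funM => //; apply: continuous_measurable_fun; exact: continuous_reflect.
- by move=> t; rewrite normrM ler_pM.
- move=> t; rewrite in_itv /= -ler_distlC -ltNge => et.
  by have [_ ->] := kp; rewrite ?mulr0.
Qed.

Lemma kern_mul_reflect_integrable s :
  lam.-integrable setT (EFin \o (fun t => g (s - t) * psi t)).
Proof.
have [M M0 pM] := kern_bounded e0 kp.
apply: (@integrable_compact_support _ (K * M) (- e) e).
- apply: measurable_funM; last by apply: continuous_measurable_fun; exact: kern_continuous kp.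
  apply: measurableT_comp => //; apply: continuous_measurable_fun.
  by apply: continuous_funB => u; [exact: cvg_cst|exact: cvg_id].
- by move=> t; rewrite normrM ler_pM.
- move=> t; rewrite in_itv /= -ler_norml -ltNge => et.
  by have [_ ->] := kp; rewrite ?mulr0.
Qed.

(** The form in which the function carries the shift, which is the one that
    shows how Lipschitz bounds and derivatives of [g] are inherited. *)
Lemma conv_shift s : conv psi g s = \int[lam]_t (g (s - t) * psi t).
Proof.
rewrite /conv -(@Rintegral_reflect s (fun t => g t * psi (s - t))); last 2 first.
- by apply: measurable_funM => //; apply: continuous_measurable_fun; exact: continuous_reflect.
- apply: eq_integrable (kern_mul_reflect_integrable s) => // t _.
  by rewrite /= subKr.
by apply: eq_Rintegral => t _; rewrite subKr.
Qed.

Lemma is_derive_kern_shift (c t x : R) :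
  is_derive x 1 (fun s => c * psi (s - t)) (c * derive1 psi (x - t)).
Proof.
apply: is_derive_cvg.
have := kern_derivable (t := x - t) kp.
rewrite /derivable => /cvg_ex[l /= Hl].
have -> : derive1 psi (x - t) = l.
  rewrite derive1E; apply: cvg_lim => //.
have E : (fun h : R => h^-1 * (c * psi (h + x - t) - c * psi (x - t))) =
    (fun h : R => c * (h^-1 *: ((psi \o shift (x - t)) (h *: 1) - psi (x - t)))).
  apply/funext => h; rewrite /= [h *: 1]mulr1 /GRing.scale /= addrA.
  by rewrite -mulrBr mulrCA.
by rewrite E; apply: cvgM => //; exact: cvg_cst.
Qed.

(** Differentiation under the integral sign, with a dominating function that is
    constant on the interval reached by the support of the kernel as [x] runs
    over a unit neighbourhood of [s]. *)
Lemma conv_is_derive s : is_derive s 1 (conv psi g) (conv (derive1 psi) g s).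
Proof.
have kp' := kern_derive kp.
have [M M0 pM] := kern_bounded e0 kp'.
have K0 : 0 <= K by apply: le_trans (gK 0).
pose f (x t : R) := g t * psi (x - t).
(* Dominates the derivative in [x] for all [x] at distance less than [1] of [s]. *)
pose G := fun t : R => (K * M) * \1_`[s - 1 - e, s + 1 + e] t.
have Is : s \in `]s - 1, s + 1[ by rewrite in_itv /=; apply/andP; split; lra.
have d1 x t : derive1 (fun x => f x t) x = g t * derive1 psi (x - t).
  by rewrite derive1E; have [_ ->] := is_derive_kern_shift (g t) t x.
have intf x : (`]s - 1, s + 1[)%classic x -> lam.-integrable setT (EFin \o f x).
  by move=> _; exact: kern_mul_integrable.
have derf x t : (`]s - 1, s + 1[)%classic x -> setT t -> derivable (f ^~ t) x 1.
  by move=> _ _; have [] := is_derive_kern_shift (g t) t x.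
have G0 t : 0 <= G t by rewrite /G mulr_ge0 ?mulr_ge0.
have intG : lam.-integrable setT (EFin \o G).
  have := integrable_indic_itv (s - 1 - e) (s + 1 + e) true false.
  by move=> /(integrableZl measurableT (K * M)); apply: eq_integrable.
have Gub x t : (`]s - 1, s + 1[)%classic x -> setT t ->
    `|partial1of2 f x t| <= G t.
  rewrite /= in_itv /= => /andP[x1 x2] _; rewrite /partial1of2 d1 /G indicE.
  have [xt|xt] := leP `|x - t| e.
    rewrite mem_set /= ?mulr1 ?normrM ?ler_pM //.
    by move: xt; rewrite in_itv /= ler_norml => /andP[? ?]; apply/andP; split; lra.
  by have [_ ->] := kp' => //; rewrite mulr0 normr0 mulr_ge0 ?mulr_ge0.
split.
  exact: (derivable_under_integral measurableT Is intf derf G0 intG Gub).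
rewrite -derive1E.
rewrite (differentiation_under_integral measurableT Is intf derf G0 intG Gub).
by apply: eq_Rintegral => t _; rewrite /partial1of2 d1.
Qed.

End conv_kernel.

Lemma kern_integrable e psi : 0 <= e -> kern e psi -> lam.-integrable setT (EFin \o psi).
Proof.
move=> e0 kp; have one : `|1 : R| <= 1 by rewrite normr1.
have := @kern_mul_reflect_integrable e psi e0 kp (fun=> 1) 1
   (measurable_cst _) (fun=> one) 0.
by apply: eq_integrable => // t _; rewrite /= mul1r.
Qed.

(** The bound [C / e] on the height, with [C] independent of the scale [e], is
    what compares a convolution with the averages in Lebesgue differentiation. *)
Definition mollifier (C e : R) rho : Prop :=
  [/\ kern e rho, forall t, 0 <= rho t, \int[lam]_t rho t = 1,
      forall t, e <= `|t| -> rho t = 0 & forall t, rho t <= C / e].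

Definition moll_cst : R := (expR (-4))^-1.

(** A rescaled bump divided by its integral.  The integral is at least
    [exp (-4) * e], which gives the bound on the height. *)
Lemma mollifier_exists e : 0 < e -> exists rho, mollifier moll_cst e rho.
Proof.
move=> e0; have e0' := ltW e0.
pose b t := bump (e^-1 * t + 0).
have bE t : b t = bump (t / e) by rewrite /b addr0 mulrC.
have bs t : e <= `|t| -> b t = 0.
  move=> et; rewrite bE bump_support // normrM (gtr0_norm (_ : 0 < e^-1)) ?invr_gt0 //.
  by rewrite ler_pdivlMr // mul1r.
have kb : kern e b.
  split; first by move=> k; apply: Ck_affine; exact: Ck_bump.
  by move=> t /ltW; exact: bs.
have b1 t : `|b t| <= 1 by rewrite ger0_norm ?bE ?bump_ge0 ?bump_le1.
have ib : lam.-integrable setT (EFin \o b).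
  apply: (@integrable_compact_support _ 1 (- e) e) => //.
    by apply: continuous_measurable_fun; exact: kern_continuous kb.
  by move=> t; rewrite in_itv /= -ler_norml -ltNge => /ltW; exact: bs.
pose c := \int[lam]_t b t.
have ce : expR (-4) * e <= c.
  have ii := integrable_indic_itv (- (e / 2)) (e / 2) true false.
  have ii' : lam.-integrable setT (EFin \o (fun t => expR (-4) * \1_(`[- (e / 2), e / 2]) t : R)).
    apply: (@integrable_compact_support _ (expR (-4)) (- (e / 2)) (e / 2)).
    - by apply: measurable_funM => //; exact: measurable_indic.
    - move=> t; rewrite indicE; case: (_ \in _); rewrite ?mulr1 ?mulr0 ?normr0 ?expR_ge0 //.
      by rewrite ger0_norm // expR_ge0.
    - by move=> t /negbTE tn; rewrite indicE memNset ?mulr0 //= tn.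
  apply: le_trans (le_Rintegral measurableT ii' ib _); last first.
    move=> t _; rewrite indicE; case: (boolP (t \in _)) => [|_]; last by rewrite mulr0 bE bump_ge0.
    rewrite inE /= in_itv /= -ler_norml mulr1 bE => te; apply: bump_half.
    rewrite normrM [`|e^-1|]gtr0_norm ?invr_gt0 // ler_pdivrMr // mulrC.
    by rewrite (le_trans te).
  rewrite RintegralZl; [|exact: measurableT|exact: ii].
  rewrite ler_wpM2l ?expR_ge0 //.
  have -> : \int[lam]_x (\1_(`[- (e / 2), e / 2]) x : R) = fine (lam (`[- (e / 2), e / 2]%classic : set R)).
    rewrite /Rintegral (@integral_indic _ _ _ lam setT measurableT _ (measurable_itv `[- (e / 2), e / 2])) //.
    by rewrite setIT.
  rewrite lebesgue_measure_itv /= lte_fin ifT; last by rewrite gtrN // divr_gt0.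
  by rewrite -EFinB /=; lra.
have c0 : 0 < c by rewrite (lt_le_trans _ ce) // mulr_gt0 ?expR_gt0.
exists (fun t => c^-1 * b t); split.
- split; last by move=> t /ltW et; rewrite bs // mulr0.
  by move=> k; apply: CkM; [exact: Ck_cst|apply: kb.1].
- by move=> t; rewrite mulr_ge0 ?invr_ge0 ?(ltW c0) // bE bump_ge0.
- by rewrite RintegralZl // mulVf // gt_eqF.
- by move=> t et; rewrite bs // mulr0.
- move=> t; rewrite /moll_cst -invfM -[leRHS]mulr1 ler_pM ?invr_ge0 ?(ltW c0) //.
  + by rewrite bE bump_ge0.
  + by rewrite lef_pV2 ?posrE // mulr_gt0 ?expR_gt0.
  + by rewrite bE bump_le1.
Qed.

Section conv_mollifier.
Variables (C e : R) (rho : R -> R) (e0 : 0 < e) (mr : mollifier C e rho).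
Variables (g : R -> R) (K : R) (mg : measurable_fun setT g)
  (gK : forall t, `|g t| <= K).

Let kr : kern e rho. Proof. by case: mr. Qed.
Let rho_ge0 t : 0 <= rho t. Proof. by case: mr. Qed.
Let rho1 : \int[lam]_t rho t = 1. Proof. by case: mr. Qed.

(** A convex average stays in every closed interval that contains the values
    averaged.  With [d = 0] this says that plateaus are preserved exactly. *)
Lemma conv_close s c d : (forall t, `|s - t| <= e -> `|g t - c| <= d) ->
  `|conv rho g s - c| <= d.
Proof.
move=> H; have ir := kern_integrable (ltW e0) kr.
have ig := kern_mul_reflect_integrable (ltW e0) kr mg gK s.
have ic (a : R) : lam.-integrable setT (EFin \o (fun t => a * rho t)).
  have := integrableZl measurableT a ir; exact: eq_integrable.
have E a : \int[lam]_t (a * rho t) = a by rewrite RintegralZl // rho1 mulr1.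
have B t : `|t| <= e -> c - d <= g (s - t) <= c + d.
  by move=> te; rewrite -ler_distl; apply: H; rewrite subKr.
have D t : (c - d) * rho t <= g (s - t) * rho t <= (c + d) * rho t.
  have [te|te] := leP `|t| e; last by have [_ ->] := kr; rewrite ?mulr0 ?lexx.
  by have /andP[? ?] := B t te; rewrite !ler_wpM2r.
rewrite (conv_shift (ltW e0) kr mg gK) ler_distl; apply/andP; split.
  rewrite -[leLHS]E; apply: le_Rintegral => // t _.
  by have /andP[] := D t.
rewrite -[leRHS]E; apply: le_Rintegral => // t _.
by have /andP[] := D t.
Qed.

(** The error is the average of [g t - g s] against a kernel of height at most
    [C / e] on a ball of length [2 e]. *)
Lemma conv_davg s : `|conv rho g s - g s| <= 2 * C * fine (davg g s e).
Proof.
have ir := kern_integrable (ltW e0) kr.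
have ig := kern_mul_integrable (ltW e0) kr mg gK s.
have mh : measurable_fun setT (fun t => g t - g s).
  by apply: measurable_funB => //; exact: measurable_cst.
have hK t : `|g t - g s| <= K + K by rewrite (le_trans (ler_normB _ _)) // lerD.
have ih := kern_mul_integrable (ltW e0) kr mh hK s.
have ic : lam.-integrable setT (EFin \o (fun t => g s * rho (s - t))).
  exact: (kern_mul_integrable (ltW e0) kr (measurable_cst (g s)) (fun=> gK s)).
have E : conv rho g s - g s = conv rho (fun t => g t - g s) s.
  rewrite /conv; under [RHS]eq_Rintegral do rewrite mulrBl.
  rewrite RintegralB //; congr (_ - _).
  have := conv_shift (ltW e0) kr (measurable_cst (g s)) (fun=> gK s) s.
  by rewrite /conv => ->; rewrite RintegralZl // rho1 mulr1.
rewrite E (le_trans (le_normr_Rintegral _ _)) //.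
have C0 : 0 <= C.
  have [_ _ _ _ /(_ 0)] := mr.
  by move=> /(le_trans (rho_ge0 0)); rewrite pmulr_lge0 ?invr_gt0.
have lA : lam (ball s e : set R) = (e *+ 2)%:E by rewrite lebesgue_measure_ball // ltW.
have mA : measurable (ball s e : set R) by exact: measurable_ball.
have iA : lam.-integrable (ball s e : set R) (EFin \o (fun t => `|g t - g s|)).
  apply: measurable_bounded_integrable => //.
  - by rewrite [X in (X < _)%E]lA ltry.
  - by apply: measurable_funTS; exact: measurableT_comp.
  - by exists (K + K); split; [exact: num_real|move=> x Kx t _ /=; rewrite normr_id (le_trans (hK t)) // ltW].
have -> : 2 * C * fine (davg g s e) = C / e * \int[lam]_(t in (ball s e : set R)) `|g t - g s|.
  rewrite /davg /iavg lA inver mulrn_eq0 /= gt_eqF // /Rintegral.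
  rewrite -[X in (_ * X)%E]fineK ?fineM //=; last exact: integrable_fin_num.
  rewrite mulrA; congr (_ * _); rewrite -mulr_natr; field.
  by rewrite gt_eqF.
have -> : \int[lam]_t `|(g t - g s) * rho (s - t)| =
    \int[lam]_(t in (ball s e : set R)) `|(g t - g s) * rho (s - t)|.
  rewrite /Rintegral [in RHS]integral_mkcond; congr fine; apply: eq_integral => t _.
  rewrite patchE; case: ifPn => // /negP tA; apply/eqP; rewrite eqe.
  rewrite normr_eq0 mulf_eq0; apply/orP; right; apply/eqP.
  have [_ _ _ -> //] := mr; rewrite leNgt; apply/negP => te; apply: tA.
  by rewrite inE -ball_normE.
rewrite -RintegralZl //; apply: le_Rintegral => //.
- apply: (@integrableS _ _ _ lam setT) => //.
  have := integrable_norm ih; exact: eq_integrable.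
- have := @integrableZl _ _ _ lam _ mA (C / e) _ iA; exact: eq_integrable.
- move=> t _; rewrite normrM mulrC ler_wpM2r // ger0_norm //.
  by case: mr.
Qed.

End conv_mollifier.

Lemma conv_lebesgue_pt C (rho : nat -> R -> R) g K s :
  (forall k, mollifier C k.+1%:R^-1 (rho k)) ->
  measurable_fun setT g -> (forall t, `|g t| <= K) -> lebesgue_pt g s ->
  conv (rho k) g s @[k --> \oo] --> g s.
Proof.
move=> mr mg gK Hs.
have H : 2 * C * fine (davg g s k.+1%:R^-1) @[k --> \oo] --> (0 : R).
  rewrite -[X in _ --> X](mulr0 (2 * C)); apply: cvgM; first exact: cvg_cst.
  have /fine_cvgP[_] := Hs.
  move=> /cvg_at_rightP; apply; split => //; exact: cvg_harmonic.
apply/cvgrPdist_le => d d0; near=> k; rewrite distrC.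
rewrite (le_trans (conv_davg _ (mr k) mg gK s)) // (le_trans (ler_norm _)) //.
by near: k; move/cvgr0Pnorm_le : H; exact.
Unshelve. all: by end_near. Qed.

End kernels.

(** * Smoothing along one coordinate *)

Section directional_smoothing.
Context {R : realType} {n : nat}.
Notation lam := (@lebesgue_measure R).
Notation delta i := (delta_mx 0 i : 'rV[R]_n).
Implicit Types (u v : 'rV[R]_n -> R) (x y : 'rV[R]_n) (i j : 'I_n).
Implicit Types (psi rho : R -> R) (e L K : R).

Definition smooth_along j psi u x : R := conv psi (fun t => u (upd x j t)) (x 0 j).

Lemma continuous_updr x j : continuous (fun t => upd x j t).
Proof.
apply/continuous_normP => s d d0; exists d => // t.
by rewrite norm_updB.
Qed.

Lemma measurable_updr x j :
  measurable_fun setT (fun t : measurableTypeR R => upd x j (t : R) : borelRn R n).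
Proof. by apply: continuous_measurable_rV2 => //; exact: measurable_cst. Qed.

Lemma measurable_line u x j : continuous u -> measurable_fun setT (fun t => u (upd x j t)).
Proof.
move=> cu; apply: continuous_measurable_fun => t.
exact: (continuous_comp (@continuous_updr x j t) (cu _)).
Qed.

(** Moving by [h] in direction [i] commutes with moving by [-t] in direction
    [j], also when [i = j]; hence difference quotients commute with
    [smooth_along]. *)
Lemma upd_shift_comm x i j (h t : R) :
  let z := upd x i (h + x 0 i) in let w := upd x j (x 0 j - t) in
  upd z j (z 0 j - t) = upd w i (h + w 0 i).
Proof.
move=> z w; apply/rowP => k; rewrite !mxE.
case: (eqVneq j i) => [->|ji]; first by rewrite ?eqxx; case: eqVneq => // _; rewrite addrA.
case: (eqVneq k j) => [->|kj]; first by rewrite (negbTE ji).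
by case: (eqVneq k i) => // ->; rewrite eq_sym (negbTE ji).
Qed.

Section kernel.
Variables (e : R) (psi : R -> R) (e0 : 0 <= e) (kp : kern e psi).

Definition kern_mass : R := \int[lam]_t `|psi t|.

Lemma kern_mass_ge0 : 0 <= kern_mass.
Proof. by apply: Rintegral_ge0. Qed.

Lemma normr_integral_kern_le (g : R -> R) K : measurable_fun setT g ->
  (forall t, `|g t| <= K) -> `|\int[lam]_t (g t * psi t)| <= K * kern_mass.
Proof.
move=> mg gK.
have gK' t : `|g (- t)| <= K by [].
have mg' : measurable_fun setT (fun t : R => g (- t)).
  apply: (measurableT_comp mg); apply: continuous_measurable_fun; exact: opp_continuous.
have ig : lam.-integrable setT (EFin \o (fun t => g t * psi t)).
  have := kern_mul_reflect_integrable e0 kp mg' gK' 0.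
  by apply: eq_integrable => // t _; rewrite /= sub0r opprK.
have ik := integrable_norm (kern_integrable e0 kp).
rewrite (le_trans (le_normr_Rintegral _ _)) // /kern_mass -RintegralZl //.
apply: le_Rintegral => //.
- by have := integrable_norm ig; exact: eq_integrable.
- by have := integrableZl measurableT K ik; exact: eq_integrable.
- by move=> t _; rewrite normrM ler_wpM2r.
Qed.

Section bounded_lipschitz.
Variables (u : 'rV[R]_n -> R) (L K : R).
Hypotheses (L0 : 0 <= L) (uL : lip u L) (uK : forall x, `|u x| <= K).
Let cu : continuous u := lip_continuous uL.

Lemma smooth_along_shift j x :
  smooth_along j psi u x = \int[lam]_t (u (upd x j (x 0 j - t)) * psi t).
Proof.
exact: (conv_shift e0 kp (measurable_line x j cu) (fun=> uK _)).
Qed.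

Lemma smooth_along_integrable j x :
  lam.-integrable setT (EFin \o (fun t => u (upd x j (x 0 j - t)) * psi t)).
Proof.
exact: (kern_mul_reflect_integrable e0 kp (measurable_line x j cu) (fun=> uK _)).
Qed.

Lemma measurable_line_reflect j x : measurable_fun setT (fun t : R => u (upd x j (x 0 j - t))).
Proof.
apply: (measurableT_comp (measurable_line x j cu)).
by apply: continuous_measurable_fun; apply: continuous_funB => t; [exact: cvg_cst|exact: cvg_id].
Qed.

(** Translations in direction [j] preserve distances, so the Lipschitz constant
    is multiplied by the mass of the kernel at most. *)
Lemma smooth_along_lip j : lip (smooth_along j psi u) (L * kern_mass).
Proof.
move=> x y; rewrite !smooth_along_shift -RintegralB //; [|exact: smooth_along_integrable..].
under eq_Rintegral do rewrite -mulrBl.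
rewrite mulrAC; apply: normr_integral_kern_le.
  by apply: measurable_funB; exact: measurable_line_reflect.
move=> t; rewrite (le_trans (uL _ _)) // ler_wpM2l // ![_ - t]addrC -!add_delta.
by rewrite opprD addrACA subrr add0r.
Qed.

Lemma smooth_along_bound j x : `|smooth_along j psi u x| <= K * kern_mass.
Proof.
by rewrite smooth_along_shift; apply: normr_integral_kern_le => //; exact: measurable_line_reflect.
Qed.

(** In the direction of smoothing the derivative falls on the kernel, and so it
    exists at every point. *)
Lemma smooth_along_derive_same j x : derivable (smooth_along j psi u) x (delta j) /\
  partialRn j (smooth_along j psi u) x = smooth_along j (derive1 psi) u x.
Proof.
have := conv_is_derive e0 kp (measurable_line x j cu) (fun=> uK _) (x 0 j).
have E : (fun t => smooth_along j psi u (upd x j t)) = conv psi (fun t => u (upd x j t)).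
  apply/funext => t; rewrite /smooth_along updE; congr conv.
  by apply/funext => s; rewrite upd_upd.
rewrite -E => -[dx xE]; split; first exact/derivable_upd.
by rewrite /partialRn derive_upd.
Qed.

Lemma measurable_partial_line i j x :
  measurable_fun setT (fun t : R => partialRn i u (upd x j t)).
Proof. exact: measurableT_comp (measurable_partialRn i cu) (measurable_updr x j). Qed.

(** Difference quotients of the smoothed function are smoothed difference
    quotients; these are bounded by [L] and converge at almost all points of the
    line, so dominated convergence applies.  The case [i = j] is
    included; the convergence of energies relies on it. *)
Lemma smooth_along_dquot_cvg i j x :
  lam.-negligible (slice x j (nonderivable u i)) ->
  dquot (smooth_along j psi u) i h x @[h --> 0^'] -->
    conv psi (fun t => partialRn i u (upd x j t)) (x 0 j).
Proof.
move=> neg.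
have pL t : `|partialRn i u (upd x j t)| <= L by exact: lip_partialRn_le.
have mp := measurable_partial_line i j x.
rewrite (conv_shift e0 kp mp pL).
pose f h t := dquot u i h (upd x j (x 0 j - t)) * psi t.
have dE h : dquot (smooth_along j psi u) i h x = \int[lam]_t f h t.
  rewrite {1}/dquot !smooth_along_shift -RintegralB //; [|exact: smooth_along_integrable..].
  rewrite -RintegralZl //; last first.
    have := integrableB measurableT (smooth_along_integrable j (upd x i (h + x 0 i))) (smooth_along_integrable j x).
    by apply: eq_integrable.
  apply: eq_Rintegral => t _; rewrite /f /dquot -mulrBl mulrA; congr (_ * (_ - _) * _).
  by rewrite upd_shift_comm.
apply/cvgr_dnbhsP => hs [hs0 hs_cvg].
under eq_fun do rewrite dE.
have mpr : measurable_fun setT (fun t : R => partialRn i u (upd x j (x 0 j - t))).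
  apply: (measurableT_comp mp).
  by apply: continuous_measurable_fun; apply: continuous_funB => t; [exact: cvg_cst|exact: cvg_id].
have mpsi : measurable_fun setT psi.
  by apply: continuous_measurable_fun; exact: kern_continuous kp.
have mf k : measurable_fun setT (fun t => (f (hs k) t)%:E).
  apply/measurable_EFinP; apply: measurable_funM => //.
  apply: (@measurableT_comp _ _ _ _ _ _ (dquot u i (hs k) : borelRn R n -> R)).
    by apply: continuous_measurable_rV; exact: continuous_dquot.
  apply: (measurableT_comp (measurable_updr x j)).
  by apply: continuous_measurable_fun; apply: continuous_funB => t; [exact: cvg_cst|exact: cvg_id].
have iG : lam.-integrable setT (EFin \o (fun t => L * `|psi t|)).
  have := integrableZl measurableT L (integrable_norm (kern_integrable e0 kp)).
  exact: eq_integrable.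
have ff : {ae lam, forall t, setT t -> (f (hs k) t)%:E @[k --> \oo] -->
    (partialRn i u (upd x j (x 0 j - t)) * psi t)%:E}.
  have [A [mA A0 NA]] := neg.
  exists [set t | A (x 0 j - t)]; split.
  - have mphi : measurable_fun setT ((fun t => x 0 j - t) : measurableTypeR R -> measurableTypeR R).
      by apply: continuous_measurable_fun; apply: continuous_funB => t; [exact: cvg_cst|exact: cvg_id].
    by rewrite -[X in measurable X]setTI; exact: mphi.
  - by rewrite lebesgue_reflect.
  - move=> t /= nt; apply: NA; rewrite /slice /nonderivable /= => dt; apply: nt => _.
    apply: cvg_EFin; first exact: nearW.
    apply: cvgM; last exact: cvg_cst.
    by have /cvgr_dnbhsP := partialRn_cvg dt; apply.
have fL : {ae lam, forall t k, setT t -> (`|(f (hs k) t)%:E| <= (L * `|psi t|)%:E)%E}.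
  apply: aeW => t k _; rewrite lee_fin normrM ler_wpM2r //.
  exact: lip_dquot_le.
have mlim : measurable_fun setT (fun t : R => (partialRn i u (upd x j (x 0 j - t)) * psi t)%:E).
  by apply/measurable_EFinP; exact: measurable_funM.
have [_ _ H] := @dominated_convergence _ _ R lam setT measurableT _ _ _ mf mlim ff iG fL.
apply: fine_cvg; rewrite fineK //.
apply: integrable_fin_num => //.
exact: (kern_mul_reflect_integrable e0 kp mp pL).
Qed.

Lemma smooth_along_derive i j x : lam.-negligible (slice x j (nonderivable u i)) ->
  derivable (smooth_along j psi u) x (delta i) /\
  partialRn i (smooth_along j psi u) x = smooth_along j psi (partialRn i u) x.
Proof.
move=> /smooth_along_dquot_cvg H; split.
  by apply/derivable_dquot/cvg_ex; eexists; exact: H.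
by rewrite /partialRn derive_dquot; exact: cvg_lim H.
Qed.

End bounded_lipschitz.
End kernel.
End directional_smoothing.

(** * Smoothing along all coordinates, with convergence of the energy *)

(** Convergence written with countable quantifiers. *)
Lemma measurable_cvg_set d (T : measurableType d) (R : realType) (a : nat -> T -> R) (b : T -> R) :
  (forall k, measurable_fun setT (a k)) -> measurable_fun setT b ->
  measurable [set x | a k x @[k --> \oo] --> b x].
Proof.
move=> ma mb.
have -> : [set x | a k x @[k --> \oo] --> b x] = \bigcap_m \bigcup_N \bigcap_(k in [set k | (N <= k)%N])
    [set x | `|b x - a k x| <= m.+1%:R^-1].
  apply/seteqP; split => x.
    move=> /= /cvgrPdist_le H m _; have m0 : 0 < m.+1%:R^-1 :> R by rewrite invr_gt0.
    by have [N _ HN] := H _ m0; exists N.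
  move=> H /=; apply/cvgrPdist_le => e e0.
  have [m me] : exists m : nat, m.+1%:R^-1 < e.
    by exists (Num.truncn e^-1); rewrite invf_plt ?posrE // truncnS_gt.
  have [N _ HN] := H m I; exists N => // k Nk.
  by rewrite (le_trans _ (ltW me)) //; exact: HN.
apply: bigcapT_measurable => m; apply: bigcupT_measurable => N.
apply: bigcap_measurableType => k _.
rewrite (_ : mkset _ = (fun x => `|b x - a k x|) @^-1` `]-oo, m.+1%:R^-1]); last first.
  by apply/seteqP; split => x; rewrite /= in_itv.
rewrite -[X in measurable X]setTI.
have mf : measurable_fun setT (fun x => `|b x - a k x|).
  by apply: measurableT_comp => //; exact: measurable_funB.
exact: mf.
Qed.

Lemma cvg_sum_seq (R : realType) (I : Type) (r : seq I) (a : I -> nat -> R) (b : I -> R) :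
  (forall i, a i k @[k --> \oo] --> b i) ->
  \sum_(i <- r) a i k @[k --> \oo] --> \sum_(i <- r) b i.
Proof.
move=> ab; elim: r => [|i r IH].
  by rewrite big_nil; under eq_fun do rewrite big_nil; exact: cvg_cst.
rewrite big_cons; under eq_fun do rewrite big_cons.
by apply: cvgD; [exact: ab|exact: IH].
Qed.

Lemma cvge_near_le (R : realType) (a : nat -> \bar R) (l b : \bar R) :
  a k @[k --> \oo] --> l -> (l < b)%E -> \forall k \near \oo, (a k <= b)%E.
Proof.
move=> al lb; have [N _ HN] := al _ (open_ereal_lt' lb).
by exists N => // k /HN /ltW.
Qed.

Section iterated_smoothing.
Context {R : realType} {n : nat}.
Notation lam := (@lebesgue_measure R).
Notation delta i := (delta_mx 0 i : 'rV[R]_n).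
Implicit Types (u v : 'rV[R]_n -> R) (x y : 'rV[R]_n) (i j : 'I_n).
Implicit Types (ps : 'I_n -> R -> R) (l : seq 'I_n).

(** The class of functions stable under all the smoothing operations. *)
Definition bounded_lip u : Prop :=
  exists L K, [/\ 0 <= L, lip u L & forall x, `|u x| <= K].

Definition kernels ps : Prop := forall j, exists2 e, 0 <= e & kern e (ps j).

(** The directions are listed explicitly, so that properties of the full
    smoothing are proved by induction on the list. *)
Definition smooth_along_all l ps u := foldr (fun j w => smooth_along j (ps j) w) u l.

(** The kernels whose smoothing is the [i]-th partial derivative of the smoothing
    with kernels [ps]. *)
Definition derive_kernel ps i : 'I_n -> R -> R :=
  fun j => if j == i then derive1 (ps j) else ps j.

Lemma kernels_derive ps i : kernels ps -> kernels (derive_kernel ps i).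
Proof.
move=> kps j; have [e e0 ke] := kps j; exists e => //.
by rewrite /derive_kernel; case: ifP => // _; exact: kern_derive.
Qed.

Lemma smooth_along_bounded_lip e psi j u : 0 <= e -> kern e psi -> bounded_lip u ->
  bounded_lip (smooth_along j psi u).
Proof.
move=> e0 kp [L [K [L0 uL uK]]]; exists (L * kern_mass psi), (K * kern_mass psi).
split; first by rewrite mulr_ge0 // kern_mass_ge0.
  exact: (smooth_along_lip e0 kp L0 uL uK).
exact: (smooth_along_bound e0 kp uL uK).
Qed.

Lemma smooth_along_all_bounded_lip l ps u : kernels ps -> bounded_lip u ->
  bounded_lip (smooth_along_all l ps u).
Proof.
move=> kps blu; elim: l => [//|j l IH] /=.
by have [e e0 ke] := kps j; exact: smooth_along_bounded_lip e0 ke IH.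
Qed.

Lemma eq_sm_all l ps ps' u : (forall j, j \in l -> ps j = ps' j) ->
  smooth_along_all l ps u = smooth_along_all l ps' u.
Proof.
elim: l => [//|j l IH] H.
have E : smooth_along_all l ps u = smooth_along_all l ps' u.
  by apply: IH => i il; apply: H; rewrite in_cons il orbT.
transitivity (smooth_along j (ps j) (smooth_along_all l ps u)); first by [].
by rewrite E (H j (mem_head j l)).
Qed.

(** The derivative passes through the smoothings in other directions until it
    reaches the one in direction [i], where it falls on the kernel. *)
Lemma smooth_along_all_partial l ps u i : uniq l -> i \in l -> kernels ps -> bounded_lip u ->
  forall x, derivable (smooth_along_all l ps u) x (delta i) /\
    partialRn i (smooth_along_all l ps u) x = smooth_along_all l (derive_kernel ps i) u x.
Proof.
move=> + + kps blu; elim: l => [//|j l IH] /= /andP[jl ul].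
have [e e0 ke] := kps j.
have [L [K [L0 wL wK]]] := smooth_along_all_bounded_lip l kps blu.
rewrite in_cons; case: eqVneq => [-> _ x|ij /= il x].
  have [dx ->] := smooth_along_derive_same e0 ke wL wK j x; split => //.
  have -> : derive_kernel ps j j = derive1 (ps j) by rewrite /derive_kernel eqxx.
  rewrite (@eq_sm_all l (derive_kernel ps j) ps u) // => k kl.
  rewrite /derive_kernel; case: eqVneq => // kj.
  by move: jl; rewrite -kj kl.
have IHx := IH ul il.
have neg : lam.-negligible (slice x j (nonderivable (smooth_along_all l ps u) i)).
  rewrite (_ : slice _ _ _ = set0); first exact: negligible_set0.
  apply/seteqP; split => // t; rewrite /slice /nonderivable /=; apply.
  by have [] := IHx (upd x j t).
have [dx ->] := smooth_along_derive e0 ke L0 wL wK neg; split => //.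
have -> : derive_kernel ps i j = ps j by rewrite /derive_kernel eq_sym (negbTE ij).
rewrite (_ : partialRn i (smooth_along_all l ps u) = smooth_along_all l (derive_kernel ps i) u) //.
by apply/funext => y; have [_ ->] := IHx y.
Qed.

(** By [smooth_along_all_partial], the class of functions obtained by smoothing
    [u] with arbitrary kernels is stable under partial derivatives, and its
    members are continuous. *)
Lemma smooth_along_all_smooth ps u : kernels ps -> bounded_lip u ->
  smooth (smooth_along_all (enum 'I_n) ps u).
Proof.
move=> kps blu k; elim: k ps kps => [|k IH] ps kps /=.
  by have [L [K [_ /lip_continuous]]] := smooth_along_all_bounded_lip (enum 'I_n) kps blu.
split; first by have [L [K [_ /lip_continuous]]] := smooth_along_all_bounded_lip (enum 'I_n) kps blu.
move=> i.
have H := smooth_along_all_partial (enum_uniq _) (mem_enum 'I_n i) kps blu.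
split; first by move=> x; have [] := H x.
rewrite (_ : partialRn i _ = smooth_along_all (enum 'I_n) (derive_kernel ps i) u).
  by apply: IH; exact: kernels_derive.
by apply/funext => x; have [_ ->] := H x.
Qed.

Section mollifiers.
Variables (C e : R) (rho : R -> R) (e0 : 0 < e) (mr : mollifier C e rho).

Let kr : kern e rho. Proof. by case: mr. Qed.

Lemma mollifier_mass : kern_mass rho = 1.
Proof.
case: mr => _ rho0 <- _ _; apply: eq_Rintegral => t _.
by rewrite ger0_norm.
Qed.

Lemma moll_lip u L K j : 0 <= L -> lip u L -> (forall x, `|u x| <= K) ->
  lip (smooth_along j rho u) L.
Proof.
by move=> L0 uL uK; have := smooth_along_lip (ltW e0) kr L0 uL uK j; rewrite mollifier_mass mulr1.
Qed.

Lemma moll_bound u L K j : lip u L -> (forall x, `|u x| <= K) ->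
  forall x, `|smooth_along j rho u x| <= K.
Proof.
by move=> uL uK x; have := smooth_along_bound (ltW e0) kr uL uK j x; rewrite mollifier_mass mulr1.
Qed.

Lemma moll_close u L K j x c d : lip u L -> (forall x, `|u x| <= K) ->
  (forall y, `|x - y| <= e -> `|u y - c| <= d) -> `|smooth_along j rho u x - c| <= d.
Proof.
move=> uL uK H; apply: (conv_close e0 mr (measurable_line x j (lip_continuous uL)) (fun=> uK _)).
by move=> t xt; apply: H; rewrite -{1}(upd_id x j) norm_updB.
Qed.

End mollifiers.

Section energy.
Variable mu : probability (borelRn R n) R.
Hypothesis mu_ac : mu `<< @lebesgueRn R n.

Lemma mu_null N : measurable N -> @lebesgueRn R n N = 0%E -> mu N = 0%E.
Proof.
have [m mE] := @lebesgueRn_measure R n.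
move: mu_ac; rewrite mE => /null_content_dominatesP H mN; exact: H.
Qed.

(** It is enough to show that almost every line in direction [j] meets the
    exceptional set in a null set.  For almost every line the [i]-th partial
    derivative of [u] exists almost everywhere on the line; then the partial
    derivative of the smoothed function is the convolution of a bounded function
    on the line, which converges at its Lebesgue points. *)
Lemma smooth_along_partial_cvg_null u L K j i (rho : nat -> R -> R) :
  0 <= L -> lip u L -> (forall x, `|u x| <= K) ->
  (forall k, mollifier moll_cst k.+1%:R^-1 (rho k)) ->
  mu (~` [set x : borelRn R n | partialRn i (smooth_along j (rho k) u) x @[k --> \oo] --> partialRn i u x]) = 0%E.
Proof.
move=> L0 uL uK mr; have cu := lip_continuous uL.
have k0 k : 0 < k.+1%:R^-1 :> R by rewrite invr_gt0.
set B := ~` _.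
have mB : measurable B.
  apply: measurableC; apply: measurable_cvg_set; last exact: measurable_partialRn.
  move=> k; apply: measurable_partialRn; apply: lip_continuous.
  exact: (moll_lip (k0 k) (mr k) j L0 uL uK).
have mN := measurable_nonderivable i cu.
have mN1 := measurable_fat_slices j mN.
have N10 : @lebesgueRn R n (fat_slices j (nonderivable u i)) = 0%E.
  by apply/(lebesgueRn_null_slices j mN); exact: lip_nonderivable_null uL.
apply: mu_null => //.
have [m mE] := @lebesgueRn_measure R n.
(* The lines along which the partial derivative fails on a non-null set are
   removed first; their union is null. *)
suff H : @lebesgueRn R n (B `\` fat_slices j (nonderivable u i)) = 0%E.
  move: H N10; rewrite mE => H N10; apply: (measure_negligible mB).
  apply: (@negligibleS _ _ _ m _ _ (_ : B `<=` (B `\` fat_slices j (nonderivable u i)) `|` fat_slices j (nonderivable u i))).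
    by move=> x Bx; have [?|?] := pselect (fat_slices j (nonderivable u i) x); [right|left].
  apply: negligibleU; apply/negligibleP => //; exact: measurableD.
have mD : measurable (B `\` fat_slices j (nonderivable u i)) by exact: measurableD.
apply/(lebesgueRn_null_slices j mD).
rewrite mE (_ : fat_slices _ _ = set0) ?measure0 //.
apply/seteqP; split => x //=; rewrite /fat_slices /= => /eqP; apply.
have slice_line t A : slice (upd x j t) j A = slice x j A.
  by apply/funext => s; rewrite /slice /= upd_upd.
have msl A : measurable A -> measurable (slice x j A : set (measurableTypeR R)).
  by move=> mA; rewrite -[X in measurable X]setTI; exact: measurable_updr.
have [good|bad] := pselect (lam (slice x j (nonderivable u i)) = 0%E); last first.
  rewrite (_ : slice _ _ _ = set0) ?measure0 //; apply/seteqP; split => t //.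
  move=> [_ H]; exfalso; apply: H.
  by rewrite /fat_slices /mkset slice_line; apply/eqP.
have neg t : lam.-negligible (slice (upd x j t) j (nonderivable u i)).
  rewrite slice_line.
  by exists (slice x j (nonderivable u i)); split; [exact: msl|exact: good|].
pose g t := partialRn i u (upd x j t).
have mg : measurable_fun setT g by exact: measurable_partial_line uL i j x.
have gL t : `|g t| <= L by exact: lip_partialRn_le.
have lg : locally_integrable setT g.
  split => //; first exact: openT.
  move=> A _ cA; have mA := compact_measurable cA.
  have /integrableP[_] : lam.-integrable A (EFin \o g).
    apply: measurable_bounded_integrable => //; first exact: compact_finite_measure.
      exact: measurable_funTS.
    by exists L; split; [exact: num_real|move=> x0 Lx0 t _; rewrite /= (le_trans (gL t)) // ltW].
  by [].
have := lebesgue_differentiation lg => -[A [mA A0 NA]].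
apply: (measure_negligible (msl _ mD)); exists A; split => // t.
rewrite /slice /= => -[Bt _]; apply: NA => /= lpt; apply: Bt => /=.
have E k : partialRn i (smooth_along j (rho k) u) (upd x j t) = conv (rho k) g t.
  have [kk _ _ _ _] := mr k.
  have [_ ->] := smooth_along_derive (ltW (k0 k)) kk L0 uL uK (neg t).
  rewrite /smooth_along updE (_ : (fun s => _) = g) //.
  by apply/funext => s; rewrite upd_upd.
under eq_fun do rewrite E.
exact: (conv_lebesgue_pt mr mg gL lpt).
Qed.

Lemma sqnorm_grad_le u L x : 0 <= L -> lip u L -> sqnorm (grad u x) <= n%:R * L ^+ 2.
Proof.
move=> L0 uL; rewrite /sqnorm.
rewrite (@le_trans _ _ (\sum_(i < n) L ^+ 2)) //; last first.
  by rewrite sumr_const card_ord mulr_natl.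
apply: ler_sum => i _; rewrite /grad mxE.
by rewrite -(real_normK (num_real _)) lerXn2r ?nnegrE //; exact: lip_partialRn_le.
Qed.

(** The gradients converge almost everywhere and are bounded by a constant that
    depends only on the dimension and on the Lipschitz constant. *)
Lemma smooth_along_energy_cvg u L K j (rho : nat -> R -> R) :
  0 <= L -> lip u L -> (forall x, `|u x| <= K) ->
  (forall k, mollifier moll_cst k.+1%:R^-1 (rho k)) ->
  energy mu (smooth_along j (rho k) u) @[k --> \oo] --> energy mu u.
Proof.
move=> L0 uL uK mr; have cu := lip_continuous uL.
have k0 k : 0 < k.+1%:R^-1 :> R by rewrite invr_gt0.
have sL k : lip (smooth_along j (rho k) u) L by exact: (moll_lip (k0 k) (mr k) j L0 uL uK).
have iC : mu.-integrable [set: borelRn R n] (EFin \o (fun=> n%:R * L ^+ 2)).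
  exact: finite_measure_integrable_cst.
have [] // := @dominated_convergence _ (borelRn R n) R mu setT measurableT
  (fun k x => (sqnorm (grad (smooth_along j (rho k) u) x))%:E)
  (fun x => (sqnorm (grad u x))%:E) (EFin \o (fun=> n%:R * L ^+ 2)).
- by move=> k; apply: measurable_sqnorm_grad; exact: lip_continuous (sL k).
- exact: measurable_sqnorm_grad.
- have H i : mu.-negligible (~` [set x : borelRn R n |
      partialRn i (smooth_along j (rho k) u) x @[k --> \oo] --> partialRn i u x]).
    exists (~` [set x : borelRn R n | partialRn i (smooth_along j (rho k) u) x @[k --> \oo] --> partialRn i u x]).
    split => //; last exact: smooth_along_partial_cvg_null L0 uL uK mr.
    apply: measurableC; apply: measurable_cvg_set; last exact: measurable_partialRn.
    by move=> k; apply: measurable_partialRn; exact: lip_continuous (sL k).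
  have : \forall x \ae mu, forall k : nat, forall i : 'I_n, val i = k ->
      partialRn i (smooth_along j (rho k0) u) x @[k0 --> \oo] --> partialRn i u x.
    apply: ae_foralln => k; have [kn|nk] := ltnP k n; last first.
      by apply: aeW => x i ik; have := ltn_ord i; rewrite ltnNge /= ik nk.
    apply: negligibleS (H (Ordinal kn)) => x /= nx cx; apply: nx => i ik.
    by rewrite (_ : i = Ordinal kn) //; apply/val_inj.
  move=> Hae; apply: negligibleS Hae => x /= nx cx; apply: nx => _.
  apply: cvg_EFin; first exact: nearW.
  apply: cvg_sum_seq => i; rewrite /grad mxE.
  under eq_fun do rewrite mxE.
  have /(_ (i : nat) i erefl) ci := cx.
  exact: (cvgM ci ci).
- apply: aeW => x k _; rewrite lee_fin /= ger0_norm ?sqnorm_ge0 //.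
  exact: sqnorm_grad_le.
Qed.

(** One direction at a time: the scale in direction [j] is chosen after the
    smoothing in the previous directions is fixed, small enough to lose at most
    half of the remaining allowance in energy and in distance.  A joint limit
    would require an approximation theorem in [R^n]; the successive choice only
    uses the convergence in one direction. *)
Lemma mollify_directions u L K l d eta : 0 <= L -> lip u L -> (forall x, `|u x| <= K) ->
  0 < d -> 0 < eta -> uniq l ->
  exists ps, [/\ kernels ps, lip (smooth_along_all l ps u) L, forall x, `|smooth_along_all l ps u x| <= K,
    (energy mu (smooth_along_all l ps u) <= energy mu u + eta%:E)%E &
    forall x c r, (forall y, `|x - y| <= d -> `|u y - c| <= r) ->
      `|smooth_along_all l ps u x - c| <= r].
Proof.
move=> L0 uL uK.
elim: l d eta => [|j l IH] d eta d0 eta0.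
  (* The kernels of directions outside the list are arbitrary. *)
  move=> _; have [rho mr] := @mollifier_exists R 1 ltr01.
  exists (fun=> rho); split => //.
  - by move=> j; exists 1 => //; case: mr.
  - by rewrite leeDl // lee_fin ltW.
  - by move=> x c r; apply; rewrite subrr normr0 ltW.
move=> /= /andP[jl ul].
have d2 : 0 < d / 2 by rewrite divr_gt0.
have eta2 : 0 < eta / 2 by rewrite divr_gt0.
have [ps [kps wL wK we wc]] := IH _ _ d2 eta2 ul.
set w := smooth_along_all l ps u in wL wK we wc.
have [rho mr] := choice (fun k => @mollifier_exists R k.+1%:R^-1 (ltac:(by rewrite invr_gt0))).
have wfin : energy mu w \is a fin_num.
  rewrite ge0_fin_numE; last by apply: integral_ge0 => x _; rewrite lee_fin sqnorm_ge0.
  apply: (@le_lt_trans _ _ (\int[mu]_(x in [set: borelRn R n]) (n%:R * L ^+ 2)%:E)%E).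
    apply: ge0_le_integral => //.
    - by move=> x _; rewrite lee_fin sqnorm_ge0.
    - by apply: measurable_sqnorm_grad; exact: lip_continuous wL.
    - by move=> x _; rewrite lee_fin; exact: sqnorm_grad_le.
  by rewrite integral_cst //= probability_setT mule1 ltry.
have Hc := smooth_along_energy_cvg j L0 wL wK mr.
have [k [ke kd]] : exists k, (energy mu (smooth_along j (rho k) w) <= energy mu w + (eta / 2)%:E)%E
    /\ k.+1%:R^-1 <= d / 2.
  have lt : (energy mu w < energy mu w + (eta / 2)%:E)%E by rewrite lteDl // lte_fin.
  have H1 : \forall k \near \oo, (energy mu (smooth_along j (rho k) w) <= energy mu w + (eta / 2)%:E)%E.
    exact: cvge_near_le Hc lt.
  have H2 : \forall k \near \oo, k.+1%:R^-1 <= d / 2 :> R.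
    have := near_infty_natSinv_lt (PosNum d2).
    by apply: filterS => k /ltW.
  by near \oo => k; exists k; split; near: k.
exists (fun i => if i == j then rho k else ps i).
have k0 : 0 < k.+1%:R^-1 :> R by rewrite invr_gt0.
have E : smooth_along_all l (fun i => if i == j then rho k else ps i) u = w.
  apply: eq_sm_all => i il; case: eqVneq => // ij.
  by move: jl; rewrite -ij il.
rewrite E eqxx; split.
- move=> i; case: eqVneq => // _; exists k.+1%:R^-1; first exact: ltW.
  by case: (mr k).
- exact: (moll_lip k0 (mr k) j L0 wL wK).
- exact: (moll_bound k0 (mr k) j wL wK).
- apply: (le_trans ke).
  have -> : eta%:E = ((eta / 2)%:E + (eta / 2)%:E)%E by rewrite -EFinD -splitr.
  by rewrite addeA; apply: leeD2r; exact: we.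
- move=> x c r H.
  apply: (@moll_close moll_cst _ (rho k) k0 (mr k) w L K j x c r wL wK) => y xy.
  apply: wc => z yz; apply: H.
  rewrite (le_trans (ler_distD y _ _)) // [leRHS](splitr d) lerD //.
  exact: le_trans xy kd.
Unshelve. all: by end_near. Qed.

End energy.
End iterated_smoothing.

(** * Truncation of locally Lipschitz functions *)

Section truncation.
Context {R : realType} {n : nat}.
Notation delta i := (delta_mx 0 i : 'rV[R]_n).
Implicit Types (f u w b : 'rV[R]_n -> R) (x y : 'rV[R]_n) (i : 'I_n).

Definition clamp (t : R) : R := Num.min 1 (Num.max 0 t).

Lemma clamp_ge0 t : 0 <= clamp t.
Proof. by rewrite /clamp le_min ler01 le_max lexx. Qed.

Lemma clamp_le1 t : clamp t <= 1.
Proof. by rewrite /clamp ge_min lexx. Qed.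

Lemma clamp_eq0 t : t <= 0 -> clamp t = 0.
Proof. by move=> t0; rewrite /clamp max_l // min_r. Qed.

Lemma clamp_eq1 t : 1 <= t -> clamp t = 1.
Proof. by move=> t1; rewrite /clamp max_r ?min_l // (le_trans ler01). Qed.

Lemma normrB_min (a b c d : R) :
  `|Num.min a b - Num.min c d| <= Num.max `|a - c| `|b - d|.
Proof.
have := lexx (Num.max `|a - c| `|b - d|); rewrite {1}ge_max !ler_norml.
move=> /andP[/andP[? ?] /andP[? ?]].
by case: (leP a b) => ?; case: (leP c d) => ?; apply/andP; split; lra.
Qed.

Lemma normrB_max (a b c d : R) :
  `|Num.max a b - Num.max c d| <= Num.max `|a - c| `|b - d|.
Proof.
have := lexx (Num.max `|a - c| `|b - d|); rewrite {1}ge_max !ler_norml.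
move=> /andP[/andP[? ?] /andP[? ?]].
by case: (leP a b) => ?; case: (leP c d) => ?; apply/andP; split; lra.
Qed.

Lemma clamp_lip s t : `|clamp s - clamp t| <= `|s - t|.
Proof.
rewrite /clamp (le_trans (normrB_min _ _ _ _)) // subrr normr0 ge_max normr_ge0 /=.
by rewrite (le_trans (normrB_max _ _ _ _)) // subrr normr0 ge_max normr_ge0 lexx.
Qed.

(** A comparison of increments takes the place of the chain rule, which is not
    available at the corners of a truncation. *)
Lemma dquot_le_partial (c : R) u w i x : 0 <= c ->
  (forall y, `|u y - u x| <= c * `|w y - w x|) ->
  derivable u x (delta i) -> derivable w x (delta i) ->
  `|partialRn i u x| <= c * `|partialRn i w x|.
Proof.
move=> c0 H du dw.
have cu : `|dquot u i h x| @[h --> (0 : R)^'] --> `|partialRn i u x|.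
  exact: cvg_norm (partialRn_cvg du).
have cw : (c * `|dquot w i h x|) @[h --> (0 : R)^'] --> c * `|partialRn i w x|.
  by apply: cvgM; [exact: cvg_cst|exact: cvg_norm (partialRn_cvg dw)].
apply: (ler_cvg_to cu cw); near=> h.
by rewrite /dquot !normrM mulrCA ler_wpM2l.
Unshelve. all: by end_near. Qed.

(** If [w], or [- w] when [b] is true, stays below a cone of slope [c] with
    apex at [x], then the two one-sided derivatives at [x] have opposite bounds;
    where [w] is derivable they coincide, and [c] bounds their absolute value. *)
Lemma partial_touching (b : bool) (c : R) w i x : derivable w x (delta i) ->
  (forall y, (-1) ^+ b * (w y - w x) <= c * `|y - x|) ->
  `|partialRn i w x| <= c.
Proof.
move=> dw H; set l := partialRn i w x.
have Hd h : h != 0 -> (-1) ^+ b * (h * dquot w i h x) <= c * `|h|.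
  move=> h0; rewrite /dquot mulVKf // (le_trans (H _)) //.
  by rewrite -[X in `|_ - X|](upd_id x i) norm_updB addrK.
have near_h (P : R -> Prop) : (\forall h \near (0 : R)^', P (dquot w i h x)) ->
    exists2 e : R, 0 < e & P (dquot w i e x) /\ P (dquot w i (- e) x).
  move=> [e /= e0 He]; exists (e / 2); first by rewrite divr_gt0.
  have e2 : `|e / 2| < e by rewrite gtr0_norm ?divr_gt0 // ltr_pdivrMr // ltr_pMr // ltr1n.
  by split; apply: He; rewrite /ball_ /= ?sub0r ?normrN ?oppr_eq0 // gt_eqF // divr_gt0.
have cl : dquot w i h x @[h --> 0^'] --> l := partialRn_cvg dw.
rewrite leNgt; apply/negP => cl'.
have [l0|l0] := leP 0 l.
- rewrite ger0_norm // in cl'.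
  have /(near_h (fun z => c < z))[e e0 [P1 P2]] : \forall h \near (0 : R)^', c < dquot w i h x.
    by apply: cvgr_gt cl'; exact: cl.
  have en0 : e != 0 by rewrite gt_eqF.
  have emn0 : - e != 0 by rewrite oppr_eq0.
  have := Hd _ en0; have := Hd _ emn0.
  rewrite normrN gtr0_norm //; case: (b); rewrite ?expr0 ?expr1.
    by nra.
  by nra.
- rewrite ltr0_norm // in cl'.
  have cl2 : l < - c by lra.
  have /(near_h (fun z => z < - c))[e e0 [P1 P2]] : \forall h \near (0 : R)^', dquot w i h x < - c.
    by apply: cvgr_lt cl2; exact: cl.
  have en0 : e != 0 by rewrite gt_eqF.
  have emn0 : - e != 0 by rewrite oppr_eq0.
  have := Hd _ en0; have := Hd _ emn0.
  rewrite normrN gtr0_norm //; case: (b); rewrite ?expr0 ?expr1.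
    by nra.
  by nra.
Qed.

Lemma locally_lipschitz_continuous f : locally_lipschitz f -> continuous f.
Proof.
move=> fl; apply/continuous_normP => x e e0.
have [U Ux [M0 [M0r HM]]] := fl x.
pose M := `|M0| + 1.
have MM : M0 < M by rewrite /M (le_lt_trans (ler_norm M0)) // ltrDl.
have M1 : 0 < M by rewrite /M ltr_wpDl.
have {}HM := HM _ MM.
have [r /= r0 rU] := (nbhs_ballP _ _).1 Ux.
exists (Num.min r (e / M)); first by rewrite lt_min r0 divr_gt0.
move=> y; rewrite lt_min => /andP[xr xe].
have Uy : U y by apply: rU; rewrite -ball_normE.
have Ux' : U x by exact: nbhs_singleton.
have := HM (x, y) (conj Ux' Uy); rewrite /= => H.
by rewrite (le_lt_trans H) // mulrC -ltr_pdivlMr.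
Qed.

(** Compactness gives one integer [N] that bounds [f] on [K] and is a Lipschitz
    constant at distances below [1/(N+1)].  For points farther apart the
    difference is at most [2 N], which is a multiple of their distance. *)
Lemma locally_lipschitz_compact f (K : set 'rV[R]_n) : locally_lipschitz f -> compact K ->
  exists2 M, 0 <= M & forall x y, K x -> K y -> `|f x - f y| <= M * `|x - y|.
Proof.
move=> fl /compact_near_coveringP cK.
(* One integer serves as bound, as local Lipschitz constant, and as inverse of
   the radius, so that the covering argument has a single parameter. *)
pose P (N : nat) x := `|f x| <= N%:R /\
  forall y, `|x - y| < N.+1%:R^-1 -> `|f x - f y| <= N%:R * `|x - y|.
have [N _ HN] : \forall N \near \oo, K `<=` P N.
  apply: cK => x Kx.
  have [U Ux [M0 [M0r HM]]] := fl x.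
  pose M := `|M0| + 1.
  have MM : M0 < M by rewrite /M (le_lt_trans (ler_norm M0)) // ltrDl.
  have {}HM := HM _ MM.
  have [r /= r0 rU] := (nbhs_ballP _ _).1 Ux.
  have r2 : 0 < r / 2 by rewrite divr_gt0.
  have M1 : 0 < M by rewrite /M ltr_wpDl.
  exists (ball x (r / 2), [set N | (Num.truncn (M + (r / 2)^-1 + `|f x| + M * r) < N)%N]).
    split => /=; first by exact: nbhsx_ballx.
    by exists (Num.truncn (M + (r / 2)^-1 + `|f x| + M * r)).+1.
  move=> [z N] /= [xz NN]; rewrite -ball_normE /= in xz.
  have NL : M + (r / 2)^-1 + `|f x| + M * r < N%:R.
    by rewrite (lt_le_trans (truncnS_gt _)) // ler_nat.
  have rr : 0 < (r / 2)^-1 by rewrite invr_gt0.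
  have Mr : 0 < M * r by rewrite mulr_gt0.
  have Uz : U z by apply: rU; rewrite -ball_normE /= (lt_trans xz) // ltr_pdivrMr // ltr_pMr // ltr1n.
  have Ux' : U x by exact: nbhs_singleton.
  split.
    have := HM (z, x) (conj Uz Ux'); rewrite /= => H.
    have fz : `|f z| <= `|f z - f x| + `|f x| by rewrite -{1}(subrK (f x) (f z)) ler_normD.
    rewrite (le_trans fz) // ltW // (le_lt_trans _ NL) // (le_trans (lerD H (lexx _))) //.
    have zr : M * `|z - x| <= M * r.
      rewrite ler_wpM2l ?(ltW M1) // distrC ltW // (lt_trans xz) //.
      by rewrite ltr_pdivrMr // ltr_pMr // ltr1n.
    by move: zr rr M1; set a := M * _; set b := M * r; set c := _^-1; lra.
  move=> y zy.
  have Uy : U y.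
    apply: rU; rewrite -ball_normE /= (le_lt_trans (ler_distD z _ _)) //.
    rewrite [ltRHS](splitr r) ltrD // (lt_trans zy) // invf_plt ?posrE //.
    rewrite (@lt_trans _ _ N%:R) ?ltr_nat //; apply: le_lt_trans NL.
    by move: rr Mr M1 (normr_ge0 (f x)); set a := _^-1; set b := M * r; lra.
  have := HM (z, y) (conj Uz Uy); rewrite /= => H.
  rewrite (le_trans H) // ler_wpM2r // ltW // (le_lt_trans _ NL) //.
  by move: rr Mr (normr_ge0 (f x)); set a := _^-1; set b := M * r; lra.
have {}HN := HN N (leqnn N).
have N0 : 0 <= (N%:R : R) by [].
exists (N%:R + 2 * N%:R * N.+1%:R); first by rewrite addr_ge0 ?mulr_ge0.
move=> x y Kx Ky; have [fx Hx] := HN x Kx; have [fy _] := HN y Ky.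
have [xy|xy] := ltP `|x - y| N.+1%:R^-1.
  by rewrite (le_trans (Hx y xy)) // ler_wpM2r // lerDl !mulr_ge0.
rewrite (@le_trans _ _ (2 * N%:R)) //.
  by rewrite (le_trans (ler_normB _ _)) // mulr_natl mulr2n lerD.
rewrite [leRHS]mulrDl; apply: (@le_trans _ _ (2 * N%:R * N.+1%:R * `|x - y|)); last first.
  by rewrite lerDr mulr_ge0.
rewrite -[leRHS]mulrA ler_peMr ?mulr_ge0 //.
by rewrite -ler_pdivrMl // mulr1.
Qed.

Section cutoff.
Variables (f : 'rV[R]_n -> R) (s r : R).
Hypotheses (fl : locally_lipschitz f) (s0 : 0 < s) (r0 : 0 < r).

Definition tent x : R := s * clamp (2 - r^-1 * `|x|).

Definition cutoff x : R := Num.min (Num.max 0 (f x)) (tent x).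

Lemma tent_ge0 x : 0 <= tent x.
Proof. by rewrite mulr_ge0 ?clamp_ge0 // ltW. Qed.

Lemma tent_lip : lip tent (s / r).
Proof.
move=> x y; rewrite /tent -mulrBr normrM (gtr0_norm s0) -mulrA ler_wpM2l ?(ltW s0) //.
rewrite (le_trans (clamp_lip _ _)) // opprB addrC addrA subrK -mulrBr normrM.
rewrite gtr0_norm ?invr_gt0 // ler_wpM2l ?invr_ge0 ?(ltW r0) // distrC.
exact: ler_dist_dist.
Qed.

Lemma tent_in x : `|x| <= r -> tent x = s.
Proof.
move=> xr; rewrite /tent clamp_eq1 ?mulr1 // lerBrDr -lerBrDl.
by rewrite ler_pdivrMl // (_ : 2 - 1 = 1) ?mulr1 //; lra.
Qed.

Lemma tent_out x : 2 * r <= `|x| -> tent x = 0.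
Proof.
by move=> xr; rewrite /tent clamp_eq0 ?mulr0 // subr_le0 ler_pdivlMl // mulrC.
Qed.

Lemma cutoff_ge0 x : 0 <= cutoff x.
Proof. by rewrite /cutoff le_min tent_ge0 le_max lexx. Qed.

Lemma cutoff_le_tent x : cutoff x <= tent x.
Proof. by rewrite /cutoff ge_min lexx orbT. Qed.

Lemma cutoff_le x t : 0 <= t -> f x <= t -> cutoff x <= t.
Proof. by move=> t0 ft; rewrite /cutoff ge_min ge_max t0 ft. Qed.

Lemma cutoff_in x : `|x| <= r -> s <= f x -> cutoff x = s.
Proof.
move=> xr sf; rewrite /cutoff tent_in // max_r ?min_r //.
by rewrite (le_trans _ sf) // ltW.
Qed.

(** [cutoff] is supported in a compact ball, on which [f] has a Lipschitz
    constant.  When one of the points is outside, the value at the other point is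
    controlled by the tent alone. *)
Lemma cutoff_lip : exists2 L, 0 <= L & lip cutoff L.
Proof.
have cK : compact [set x : 'rV[R]_n | `|x| <= 2 * r].
  apply: bounded_closed_compact.
    exists (2 * r); split; first exact: num_real.
    by move=> M Mr x /= xr; rewrite (le_trans xr) // ltW.
  apply: (@closed_comp _ _ (fun x : 'rV[R]_n => `|x|) [set y | y <= 2 * r]).
    by move=> x _; exact: norm_continuous.
  exact: closed_le.
have [M M0 HM] := locally_lipschitz_compact fl cK.
exists (M + s / r); first by rewrite addr_ge0 // divr_ge0 // ltW.
have sr0 : 0 <= s / r by rewrite divr_ge0 // ltW.
have out x y : 2 * r <= `|y| -> `|cutoff x - cutoff y| <= (M + s / r) * `|x - y|.
  move=> yr; have cy : cutoff y = 0.
    by apply/eqP; rewrite eq_le cutoff_ge0 (le_trans (cutoff_le_tent y)) // tent_out.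
  rewrite cy subr0 ger0_norm ?cutoff_ge0 // (le_trans (cutoff_le_tent x)) //.
  rewrite -[leLHS]subr0 -(tent_out yr) (le_trans (ler_norm _)) // (le_trans (tent_lip _ _)) //.
  by rewrite ler_wpM2r // lerDr.
move=> x y; have [yr|yr] := leP (2 * r) `|y|; first exact: out.
have [xr|xr] := leP (2 * r) `|x|.
  by rewrite distrC [`|x - y|]distrC; exact: out.
rewrite (le_trans (normrB_min _ _ _ _)) // ge_max; apply/andP; split.
  rewrite (le_trans (normrB_max _ _ _ _)) // subrr normr0 ge_max; apply/andP; split.
    by rewrite mulr_ge0 // addr_ge0.
  rewrite (le_trans (HM x y (ltW xr) (ltW yr))) // ler_wpM2r //.
  by rewrite lerDl.
by rewrite (le_trans (tent_lip _ _)) // ler_wpM2r // lerDr.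
Qed.

(** Where [f <= 0] the cutoff has a minimum; where [f] is above the tent, the
    cutoff touches the tent from below; elsewhere it coincides with [f] near [x]. *)
Lemma cutoff_partial i x : derivable cutoff x (delta i) ->
  `|partialRn i cutoff x| <= Num.max `|partialRn i f x| (s / r).
Proof.
move=> dw; have sr0 : 0 <= s / r by rewrite divr_ge0 // ltW.
have cf := locally_lipschitz_continuous fl.
have ct := lip_continuous tent_lip.
rewrite le_max; apply/orP.
have [f0|f0] := leP (f x) 0.
  right; apply: (partial_touching (b := true) dw) => y.
  have -> : cutoff x = 0.
    by apply/eqP; rewrite eq_le cutoff_ge0 (cutoff_le (lexx 0) f0).
  rewrite subr0 expr1 mulN1r; apply: (@le_trans _ _ 0); last exact: mulr_ge0.
  by rewrite oppr_le0 cutoff_ge0.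
have [tf|ft] := leP (tent x) (f x).
  right; apply: (partial_touching (b := false) dw) => y.
  have -> : cutoff x = tent x.
    by rewrite /cutoff max_r ?min_r // ltW.
  rewrite expr0 mul1r (@le_trans _ _ (tent y - tent x)) ?lerD2r ?cutoff_le_tent //.
  by rewrite (le_trans (ler_norm _)) // tent_lip.
left.
suff -> : partialRn i cutoff x = partialRn i f x by [].
have [e1 e10 H1] := (continuous_normP _).1 cf x _ f0.
have ft0 : 0 < (tent x - f x) / 2 by rewrite divr_gt0 // subr_gt0.
have [e2 e20 H2] := (continuous_normP _).1 cf x _ ft0.
have [e3 e30 H3] := (continuous_normP _).1 ct x _ ft0.
rewrite /partialRn; apply: near_eq_derive; apply/nbhs_ballP.
exists (Num.min e1 (Num.min e2 e3)); first by rewrite /= !lt_min e10 e20 e30.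
move=> y; rewrite -ball_normE /= !lt_min => /andP[/H1 y1 /andP[/H2 y2 /H3 y3]].
move: y1 y2 y3; rewrite !ltr_norml => /andP[? ?] /andP[? ?] /andP[? ?].
rewrite /cutoff max_r ?min_l //; lra.
Qed.

End cutoff.

Lemma sqnorm_le_max u w (c : R) x : 0 <= c ->
  (forall i, `|partialRn i u x| <= Num.max `|partialRn i w x| c) ->
  sqnorm (grad u x) <= sqnorm (grad w x) + n%:R * c ^+ 2.
Proof.
move=> c0 H; rewrite /sqnorm.
have -> : n%:R * c ^+ 2 = \sum_(i < n) c ^+ 2 by rewrite sumr_const card_ord mulr_natl.
rewrite -big_split; apply: ler_sum => i _; rewrite /grad !mxE /=.
rewrite -[_ ^+ 2](real_normK (num_real _)) -[X in _ <= X + _](real_normK (num_real _)).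
have := H i; rewrite le_max => /orP[h|h].
  by rewrite (@le_trans _ _ (`|partialRn i w x| ^+ 2)) ?lerXn2r ?nnegrE // lerDl sqr_ge0.
by rewrite (@le_trans _ _ (c ^+ 2)) ?lerXn2r ?nnegrE // lerDr sqr_ge0.
Qed.

Lemma sqnorm_le_scale u w (c : R) x : 0 <= c ->
  (forall i, `|partialRn i u x| <= c * `|partialRn i w x|) ->
  sqnorm (grad u x) <= c ^+ 2 * sqnorm (grad w x).
Proof.
move=> c0 H; rewrite /sqnorm mulr_sumr; apply: ler_sum => i _; rewrite /grad !mxE /=.
rewrite -[_ ^+ 2](real_normK (num_real _)) -[X in _ <= _ * X](real_normK (num_real _)).
by rewrite -exprMn lerXn2r ?nnegrE ?mulr_ge0.
Qed.

Section energies.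
Variable mu : probability (borelRn R n) R.
Hypothesis mu_ac : mu `<< @lebesgueRn R n.

Lemma lip_ae_derivable u L : lip u L ->
  {ae mu, forall x : borelRn R n, forall i, derivable u (x : 'rV[R]_n) (delta i)}.
Proof.
move=> uL; have cu := lip_continuous uL.
have : \forall x \ae mu, forall k : nat, forall i : 'I_n, val i = k ->
    derivable u (x : 'rV[R]_n) (delta i).
  apply: ae_foralln => k; have [kn|nk] := ltnP k n; last first.
    by apply: aeW => x i ik; have := ltn_ord i; rewrite ltnNge /= ik nk.
  exists (nonderivable u (Ordinal kn)); split; first exact: measurable_nonderivable.
    by apply: (mu_null mu_ac); [exact: measurable_nonderivable|exact: lip_nonderivable_null uL].
  move=> x /= nx dx; apply: nx => i ik.
  by rewrite (_ : i = Ordinal kn) //; apply/val_inj.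
by move=> Hae; apply: negligibleS Hae => x /= nx H; apply: nx => i; exact: (H i).
Qed.

Lemma energy_ge0 u : (0 <= energy mu u)%E.
Proof. by apply: integral_ge0 => x _; rewrite lee_fin sqnorm_ge0. Qed.

Lemma energy_scale_le u w L M (c : R) : 0 <= c -> lip u L -> lip w M ->
  (forall x y, `|u y - u x| <= c * `|w y - w x|) ->
  (energy mu u <= (c ^+ 2)%:E * energy mu w)%E.
Proof.
move=> c0 uL wM H.
have mw := measurable_sqnorm_grad (lip_continuous wM).
have mu' := measurable_sqnorm_grad (lip_continuous uL).
rewrite /energy -ge0_integralZl_EFin ?sqr_ge0 //; last first.
  by move=> x _; rewrite lee_fin sqnorm_ge0.
apply: ae_ge0_le_integral => //.
- by move=> x _; rewrite lee_fin sqnorm_ge0.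
- by move=> x _; rewrite mule_ge0 ?lee_fin ?sqr_ge0 ?sqnorm_ge0.
- by apply: emeasurable_funM => //; exact: measurable_cst.
- have Hu := lip_ae_derivable uL; have Hw := lip_ae_derivable wM.
  apply: negligibleS (negligibleU Hu Hw) => x /= nx.
  apply: contrapT => /not_orP[/contrapT du /contrapT dw]; apply: nx => _.
  rewrite -EFinM lee_fin; apply: sqnorm_le_scale => // i.
  by apply: dquot_le_partial => // y; exact: H.
Qed.

Lemma energy_cutoff f (s r : R) : locally_lipschitz f -> 0 < s -> 0 < r ->
  (energy mu (cutoff f s r) <= energy mu f + (n%:R * (s / r) ^+ 2)%:E)%E.
Proof.
move=> fl s0 r0; have [L L0 wL] := cutoff_lip fl s0 r0.
have cf := locally_lipschitz_continuous fl.
have sr0 : 0 <= s / r by rewrite divr_ge0 // ltW.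
have c0 : 0 <= n%:R * (s / r) ^+ 2 by rewrite mulr_ge0 ?sqr_ge0.
have -> : (n%:R * (s / r) ^+ 2)%:E =
    (\int[mu]_(x in [set: borelRn R n]) (n%:R * (s / r) ^+ 2)%:E)%E.
  by rewrite integral_cst //= probability_setT mule1.
have mf := measurable_sqnorm_grad cf.
rewrite /energy -ge0_integralD //; last by move=> x _; rewrite lee_fin sqnorm_ge0.
apply: ae_ge0_le_integral => //.
- by move=> x _; rewrite lee_fin sqnorm_ge0.
- by apply: measurable_sqnorm_grad; exact: lip_continuous wL.
- by move=> x _; rewrite adde_ge0 ?lee_fin ?sqnorm_ge0.
- by apply: emeasurable_funD => //; exact: measurable_cst.
- apply: negligibleS (lip_ae_derivable wL) => x /= nx dw; apply: nx => _.
  rewrite -EFinD lee_fin; apply: sqnorm_le_max => // i.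
  exact: cutoff_partial.
Qed.

End energies.

End truncation.

(** * From level sets to the capacity of a fixed competitor *)

Section growth.
Context {R : realType}.
Variables (F : R -> R) (lambda : R).
Hypotheses (F_nondecreasing : forall x y, 0 <= x -> x <= y -> F x <= F y)
    (lambda_ge4 : 4 <= lambda)
    (F_div_nonincreasing : forall x y, 2 <= x -> x <= y -> F y / y <= F x / x)
    (F_lambda : forall x, 2 <= x -> F (lambda * x) <= lambda * F x / 4).

Let lambda_gt0 : 0 < lambda. Proof. exact: lt_le_trans lambda_ge4. Qed.

(** The left-hand side of the capacity inequality as a function of the
    measure. *)
Definition profile (a : R) := a * F a^-1.

Lemma inv_ge2 (a : R) : 0 < a -> a <= 2^-1 -> 2 <= a^-1.
Proof. by move=> a0 a2; rewrite -[leLHS]invrK lef_pV2 ?posrE. Qed.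

Lemma profile_nondecreasing (a b : R) : 0 < a -> a <= b -> b <= 2^-1 -> profile a <= profile b.
Proof.
move=> a0 ab b2; have b0 : 0 < b by rewrite (lt_le_trans a0).
have H : b^-1 <= a^-1 by rewrite lef_pV2 ?posrE.
have := F_div_nonincreasing (inv_ge2 b0 b2) H.
by rewrite !invrK /profile mulrC [leRHS]mulrC.
Qed.

(** The telescoping argument.  As long as the measures grow by a factor larger
    than [lambda], [profile] grows by a factor [4], which pays for the factor [4]
    lost by passing to a lower level; growth by such factors stops because the
    measures are bounded, and there the hypothesis at a single level applies. *)
Lemma profile_level (a : nat -> R) (X : R) : 0 < a 0%N ->
  (forall k, a k <= a k.+1) -> (forall k, a k <= 2^-1) ->
  (forall k, a k * F (a k.+1)^-1 <= 4 ^+ k.+1 * X) ->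
  profile (a 0%N) <= lambda * X.
Proof.
move=> a00 and_ a2 H.
have a0 k : 0 < a k by elim: k => // k IH; rewrite (lt_le_trans IH).
(* Otherwise [a] would grow at least geometrically with ratio [4]. *)
have ex : exists j, a j.+1 <= lambda * a j.
  apply: contrapT => /forallNP nex.
  have big k : 4 ^+ k * a 0%N <= a k.
    elim: k => [|k IH]; first by rewrite expr0 mul1r.
    have /negP := nex k; rewrite -ltNge => /ltW; apply: le_trans.
    by rewrite exprS -mulrA ler_pM // mulr_ge0 ?exprn_ge0 // ltW.
  have [N HN] : exists N : nat, 2^-1 < 4 ^+ N * a 0%N.
    exists (Num.truncn (a 0%N)^-1).+1.
    rewrite (@lt_trans _ _ 1) ?invf_lt1 ?ltr1n // -ltr_pdivrMr // mul1r.
    rewrite (lt_le_trans (truncnS_gt _)) // -natrX ler_nat.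
    by rewrite ltnW // ltn_expl.
  by have := lt_le_trans HN (big N); rewrite ltNge a2.
have G_step k : lambda * a k < a k.+1 -> profile (a k) <= profile (a k.+1) / 4.
  move=> la; have la0 : 0 < lambda * a k by rewrite mulr_gt0.
  have x2 : 2 <= (lambda * a k)^-1.
    by apply: inv_ge2 => //; rewrite (le_trans (ltW la)).
  have E : (a k)^-1 = lambda * (lambda * a k)^-1.
    by rewrite invfM mulrA divff ?mul1r // gt_eqF.
  apply: (@le_trans _ _ (profile (lambda * a k) / 4)).
    rewrite /profile E (le_trans (ler_wpM2l (ltW (a0 k)) (F_lambda x2))) //.
    by rewrite le_eqVlt; apply/orP; left; apply/eqP; ring.
  by rewrite ler_pM2r ?invr_gt0 //; apply: profile_nondecreasing => //; exact: ltW.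
case: (ex_minnP ex) => j Hj jmin.
have G0j k : (k <= j)%N -> profile (a 0%N) <= profile (a k) / 4 ^+ k.
  elim: k => [_|k IH kj]; first by rewrite expr0 divr1.
  have lk : lambda * a k < a k.+1.
    by rewrite ltNge; apply/negP => /jmin; rewrite leqNgt kj.
  rewrite (le_trans (IH (ltnW kj))) // exprS invfM mulrA.
  by rewrite ler_pM2r ?invr_gt0 ?exprn_gt0 // G_step.
rewrite (le_trans (G0j j (leqnn j))) // ler_pdivrMr ?exprn_gt0 //.
have x2 : 2 <= (a j.+1)^-1 by exact: inv_ge2.
have FE : F (a j)^-1 <= lambda * F (a j.+1)^-1 / 4.
  apply: le_trans (F_lambda x2); apply: F_nondecreasing; first by rewrite invr_ge0 ltW.
  by rewrite ler_pdivlMr // mulrC ler_pdivrMr // mulrC.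
rewrite /profile (le_trans (ler_wpM2l (ltW (a0 j)) FE)) //.
rewrite (_ : a j * _ = lambda / 4 * (a j * F (a j.+1)^-1)); last by ring.
rewrite (le_trans (ler_wpM2l _ (H j))) ?divr_ge0 ?(ltW lambda_gt0) //.
by rewrite le_eqVlt; apply/orP; left; apply/eqP; rewrite exprS; field.
Qed.

End growth.

Section sobolev_levels.
Context {R : realType} {n : nat}.
Variable mu : probability (borelRn R n) R.
Hypothesis mu_ac : mu `<< @lebesgueRn R n.
Variables (F : R -> R) (D : R).
Hypotheses (F_ge0 : forall x, 0 <= x -> 0 <= F x)
  (F_nondecreasing : forall x y, 0 <= x -> x <= y -> F x <= F y)
  (D_ge0 : 0 <= D)
  (F_Sobolev : forall f : 'rV[R]_n -> R, smooth f ->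
      (\int[mu]_x (f x ^+ 2 *
          F (f x ^+ 2 / fine (\int[mu]_y (f y ^+ 2)%:E)))%:E
        <= D%:E * energy mu f)%E).
Implicit Types (f u v w : 'rV[R]_n -> R).

Definition upper_level f (s : R) : set (borelRn R n) := [set x : 'rV[R]_n | s <= f x].

Lemma measurable_upper_level f s : continuous f -> measurable (upper_level f s).
Proof.
move=> cf; apply: closed_measurable_rV.
by apply: (@closed_comp _ _ f [set y | s <= y]) => [x _|]; [exact: cf|exact: closed_ge].
Qed.

Lemma measurable_F_sqr v (m : R) : continuous v -> 0 <= m ->
  measurable_fun setT (fun x : borelRn R n => (v x ^+ 2 * F (v x ^+ 2 / m))%:E).
Proof.
move=> cv m0; have mv := continuous_measurable_rV cv.
have mv2 : measurable_fun setT (fun x : borelRn R n => v x ^+ 2) by exact: measurable_funX.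
apply/measurable_EFinP; apply: measurable_funM => //.
(* [F] is monotone on non-negative arguments only. *)
have mF : measurable_fun setT (fun t : R => F (Num.max 0 t)).
  apply: nondecreasing_measurable => // s t st; apply: F_nondecreasing.
    by rewrite le_max lexx.
  by rewrite ge_max !le_max lexx st orbT.
rewrite (_ : (fun x => _) = (fun t : R => F (Num.max 0 t)) \o (fun x : borelRn R n => v x ^+ 2 / m)).
  by apply: measurableT_comp => //; apply: measurable_funM => //; exact: measurable_cst.
by apply/funext => x /=; rewrite max_r // divr_ge0 // sqr_ge0.
Qed.

(** On [P] the integrand is [F (1 / mu(v^2))], and [mu(v^2)] is at most the
    measure of [Q], so monotonicity of [F] applies.  Positivity of the measure of
    [P] keeps [mu(v^2)] from vanishing. *)
Lemma sobolev_plateau v (P Q : set (borelRn R n)) :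
  smooth v -> measurable P -> measurable Q ->
  (forall x, 0 <= v x <= 1) -> (forall x : 'rV[R]_n, P x -> v x = 1) ->
  (forall x : 'rV[R]_n, ~ Q x -> v x = 0) -> mu P != 0%E ->
  ((fine (mu P) * F (fine (mu Q))^-1)%:E <= D%:E * energy mu v)%E.
Proof.
move=> sv mP mQ v01 v1 v0 P0; have cv : continuous v := sv 0%N.
have mv := continuous_measurable_rV cv.
have mv2 : measurable_fun setT (fun x : borelRn R n => (v x ^+ 2)%:E).
  by apply/measurable_EFinP; exact: measurable_funX.
have fP : mu P \is a fin_num by exact: fin_num_measure.
have fQ : mu Q \is a fin_num by exact: fin_num_measure.
have iI (A : set (borelRn R n)) : measurable A -> (\int[mu]_x (\1_A x)%:E)%E = mu A.
  by move=> mA; rewrite integral_indic // setIT.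
have mI (A : set (borelRn R n)) : measurable A -> measurable_fun setT (fun x => (\1_A x : R)%:E).
  by move=> mA; apply/measurable_EFinP; exact: measurable_indic.
have Pm : (mu P <= \int[mu]_x (v x ^+ 2)%:E)%E.
  rewrite -iI //; apply: ge0_le_integral => //; first exact: mI.
  move=> x _; rewrite lee_fin indicE; case: (boolP (x \in P)) => [|_]; last by rewrite sqr_ge0.
  by rewrite inE => /v1 ->; rewrite expr1n.
have mQ' : (\int[mu]_x (v x ^+ 2)%:E <= mu Q)%E.
  rewrite -iI //; apply: ge0_le_integral => //; last 2 first.
  - exact: mI.
  - move=> x _; rewrite lee_fin indicE; case: (boolP (x \in Q)) => [_|].
      by have /andP[? ?] := v01 x; rewrite expr_le1.
    by rewrite notin_setE => /v0 ->; rewrite expr0n.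
  by move=> x _; rewrite lee_fin sqr_ge0.
apply: le_trans (F_Sobolev sv).
set m := fine (\int[mu]_y (v y ^+ 2)%:E)%E.
have fm : (\int[mu]_x (v x ^+ 2)%:E)%E \is a fin_num.
  rewrite ge0_fin_numE; last by apply: integral_ge0 => x _; rewrite lee_fin sqr_ge0.
  by rewrite (le_lt_trans mQ') // ltey_eq fQ.
have m_gt0 : 0 < m.
  rewrite -lte_fin fineK // (lt_le_trans _ Pm) // lt0e P0 /=; exact: measure_ge0.
have mq : m <= fine (mu Q) by rewrite -lee_fin !fineK.
rewrite EFinM fineK // -(iI _ mP) muleC -ge0_integralZl_EFin //; last 2 first.
- exact: mI.
- by rewrite F_ge0 // invr_ge0 (le_trans (ltW m_gt0)).
apply: ge0_le_integral => //.
- move=> x _; rewrite mule_ge0 ?lee_fin // F_ge0 // invr_ge0 (le_trans (ltW m_gt0)) //.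
- by apply: emeasurable_funM; [exact: measurable_cst|exact: mI].
- exact: measurable_F_sqr (ltW m_gt0).
- move=> x _; rewrite -EFinM lee_fin indicE; case: (boolP (x \in P)) => [|_].
    rewrite inE => /v1 ->; rewrite expr1n !mul1r mulr1.
    apply: F_nondecreasing; first by rewrite invr_ge0 (le_trans (ltW m_gt0)).
    by rewrite lef_pV2 ?posrE // (lt_le_trans m_gt0).
  by rewrite mulr0 mulr_ge0 ?sqr_ge0 // F_ge0 // divr_ge0 ?sqr_ge0 // ltW.
Qed.

(** Truncate [w] between [5/4 s] and [7/4 s], which leaves a margin of [s / 4]
    towards the levels [s] and [2 s].  Below a scale [d] determined by the
    Lipschitz constant, mollification does not see across the margin, so the
    mollified function has the plateaus that [sobolev_plateau] requires. *)
Lemma sobolev_lip w L s : 0 <= L -> lip w L -> 0 < s ->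
  ((fine (mu (upper_level w (2 * s))) * F (fine (mu (upper_level w s)))^-1)%:E
    <= (D * (2 / s) ^+ 2)%:E * energy mu w)%E.
Proof.
move=> L0 wL s0; have cw := lip_continuous wL.
have s2 : 0 <= 2 / s by rewrite divr_ge0 // ltW.
have [->|P0] := eqVneq (mu (upper_level w (2 * s))) 0%E.
  by rewrite mul0r mule_ge0 ?energy_ge0 // lee_fin mulr_ge0 ?sqr_ge0.
(* The affine map sends [5/4 s] to [0] and [7/4 s] to [1]. *)
pose u x := clamp (2 / s * w x - 5 / 2).
have uw x y : `|u x - u y| <= 2 / s * `|w x - w y|.
  rewrite (le_trans (clamp_lip _ _)) // opprD addrACA subrr addr0 -mulrBr normrM.
  by rewrite [`|2 / s|]ger0_norm.
have uL : lip u (2 / s * L).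
  by move=> x y; rewrite (le_trans (uw x y)) // -[leRHS]mulrA ler_wpM2l.
have u1 x : `|u x| <= 1 by rewrite ger0_norm ?clamp_ge0 ?clamp_le1.
have L1 : 0 < 4 * (L + 1) by rewrite mulr_gt0 // ltr_wpDl.
(* [L + 1] instead of [L], which may be [0]. *)
pose d := s / (4 * (L + 1)).
have d0 : 0 < d by rewrite divr_gt0.
have wd x y : `|x - y| <= d -> `|w x - w y| <= s / 4.
  move=> xy; rewrite (le_trans (wL x y)) // (@le_trans _ _ ((L + 1) * d)) //.
    by rewrite ler_pM // lerDl.
  by rewrite /d le_eqVlt; apply/orP; left; apply/eqP; field; rewrite gt_eqF // ltr_wpDl.
have blu : bounded_lip u by exists (2 / s * L), 1; split => //; rewrite mulr_ge0.
suff H eta : 0 < eta -> ((fine (mu (upper_level w (2 * s))) * F (fine (mu (upper_level w s)))^-1)%:E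
    <= D%:E * (energy mu u + eta%:E))%E.
  have Hu : (D%:E * energy mu u <= (D * (2 / s) ^+ 2)%:E * energy mu w)%E.
    rewrite EFinM -muleA lee_wpmul2l ?lee_fin //.
    by apply: (energy_scale_le mu_ac s2 uL wL) => x y; exact: uw.
  apply: le_trans Hu; apply/lee_addgt0Pr => e e0.
  have D1 : 0 < D + 1 by rewrite ltr_wpDl.
  have eta0 : 0 < e / (D + 1) by rewrite divr_gt0.
  apply: (le_trans (H _ eta0)).
  rewrite ge0_muleDr ?energy_ge0 ?lee_fin ?(ltW eta0) //.
  apply: leeD2l; rewrite -EFinM lee_fin mulrA ler_pdivrMr // mulrC.
  by rewrite ler_wpM2l ?(ltW e0) // lerDl.
move=> eta0.
have [ps [kps _ _ ve vc]] := mollify_directions mu_ac (mulr_ge0 s2 L0) uL u1 d0 eta0 (enum_uniq 'I_n).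
set v := smooth_along_all _ ps u in ve vc.
have sv : smooth v by exact: smooth_along_all_smooth.
have vle x c : (forall y, `|x - y| <= d -> u y = c) -> v x = c.
  move=> H; apply/eqP; rewrite -subr_eq0 -normr_le0; apply: vc => y xy.
  by rewrite H // subrr normr0.
apply: (@le_trans _ _ (D%:E * energy mu v)%E); last first.
  by apply: lee_wpmul2l; rewrite ?lee_fin.
have sn0 : s != 0 by rewrite gt_eqF.
apply: sobolev_plateau => //; try exact: measurable_upper_level.
(* The unit interval is the ball of radius [1/2] about [1/2]. *)
- move=> x; have := vc x 2^-1 2^-1; rewrite ler_distl => H.
  have /H : forall y, `|x - y| <= d -> `|u y - 2^-1| <= 2^-1.
    move=> y _; rewrite ler_distl.
    have := clamp_ge0 (2 / s * w y - 5 / 2); have := clamp_le1 (2 / s * w y - 5 / 2).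
    by rewrite -/(u y) => ? ?; apply/andP; split; lra.
  by move=> /andP[? ?]; apply/andP; split; lra.
- move=> x xP; apply: vle => y xy; rewrite /u clamp_eq1 //.
  have := wd x y xy; rewrite ler_norml => /andP[_ w1].
  have ws : 7 / 4 * s <= w y by move: xP; rewrite /upper_level /= => xP; lra.
  have E : 2 / s * (7 / 4 * s) - 5 / 2 = 1 by field.
  rewrite -[leLHS]E.
  by rewrite lerD2r ler_wpM2l.
- move=> x /negP; rewrite -ltNge => xQ; apply: vle => y xy; rewrite /u clamp_eq0 //.
  have := wd x y xy; rewrite ler_norml => /andP[w1 _].
  have ws : w y <= 5 / 4 * s by lra.
  have E : 2 / s * (5 / 4 * s) - 5 / 2 = 0 by field.
  rewrite -[leRHS]E.
  by rewrite lerD2r ler_wpM2l.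
Qed.

(** Apply [sobolev_lip] to the cutoffs of [f] at height [2 s] and radius [k+1].
    At the upper level the set of the cutoff contains the part of that of [f] in
    the ball, which increases to the whole of it; at the lower level it is
    contained in that of [f], and [F (1 / _)] is non-increasing. *)
Lemma sobolev_locally_lipschitz f s : locally_lipschitz f -> 0 < s ->
  ((fine (mu (upper_level f (2 * s))) * F (fine (mu (upper_level f s)))^-1)%:E
    <= (D * (2 / s) ^+ 2)%:E * energy mu f)%E.
Proof.
move=> fl s0; have cf := locally_lipschitz_continuous fl.
have s20 : 0 < 2 * s by rewrite mulr_gt0.
set c := D * (2 / s) ^+ 2; have c0 : 0 <= c by rewrite mulr_ge0 ?sqr_ge0.
have [->|cE] := eqVneq (c%:E * energy mu f)%E +oo%E; first by rewrite leey.
have cfin : (c%:E * energy mu f)%E \is a fin_num.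
  by rewrite ge0_fin_numE ?mule_ge0 ?energy_ge0 // ltey.
set Fq := F _; have Fq0 : 0 <= Fq by rewrite F_ge0 // invr_ge0 fine_ge0.
pose P k : set (borelRn R n) := upper_level f (2 * s) `&` [set x : 'rV[R]_n | `|x| <= k.+1%:R].
have mP k : measurable (P k).
  apply: measurableI; first exact: measurable_upper_level.
  apply: closed_measurable_rV.
  apply: (@closed_comp _ _ (fun x : 'rV[R]_n => `|x|) [set y | y <= k.+1%:R]).
    by move=> x _; exact: norm_continuous.
  exact: closed_le.
have cP : fine (mu (P k)) @[k --> \oo] --> fine (mu (upper_level f (2 * s))).
  apply: fine_cvg; rewrite fineK ?fin_num_measure //; last exact: measurable_upper_level.
  have -> : upper_level f (2 * s) = \bigcup_k P k.
    apply/seteqP; split => x; last by case=> k _ [].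
    move=> fx; exists (Num.truncn `|x|) => //; split => //=.
    by rewrite ltW // truncnS_gt.
  apply: nondecreasing_cvg_mu => //; first exact: bigcupT_measurable.
  move=> k l kl; apply/subsetPset => x [fx xk]; split => //=.
  by rewrite (le_trans xk) // ler_nat ltnS.
have H k : fine (mu (P k)) * Fq <= fine (c%:E * energy mu f) + c * (n%:R * (2 * s * k.+1%:R^-1) ^+ 2).
  have k0 : 0 < k.+1%:R :> R by [].
  have [L L0 wL] := cutoff_lip fl s20 k0.
  set w := cutoff f (2 * s) k.+1%:R in wL.
  have cw := lip_continuous wL.
  have Hw := sobolev_lip L0 wL s0.
  have PW : P k `<=` upper_level w (2 * s).
    by move=> x [fx xk]; rewrite /upper_level /= /w (cutoff_in s20 k0 xk fx).
  have WF : upper_level w s `<=` upper_level f s.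
    move=> x; rewrite /upper_level /= leNgt [in X in _ -> X]leNgt; apply: contra => fs.
    have [f0|f0] := leP 0 (f x).
      by rewrite (le_lt_trans (cutoff_le (2 * s) k.+1%:R f0 (lexx _))).
    by rewrite (le_lt_trans (cutoff_le (2 * s) k.+1%:R (lexx 0) (ltW f0))).
  have mW t := measurable_upper_level t cw.
  have mF t := measurable_upper_level t cf.
  have fm (A : set (borelRn R n)) : measurable A -> mu A \is a fin_num by exact: fin_num_measure.
  have mono (A B : set (borelRn R n)) : measurable A -> measurable B -> A `<=` B -> fine (mu A) <= fine (mu B).
    by move=> mA mB AB; rewrite fine_le ?fm // le_measure ?inE.
  have W2 : upper_level w (2 * s) `<=` upper_level w s.
    move=> x; rewrite /upper_level /=; apply: le_trans.
    by rewrite ler_peMl ?(ltW s0) // ler1n.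
  have step : fine (mu (P k)) * Fq <=
      fine (mu (upper_level w (2 * s))) * F (fine (mu (upper_level w s)))^-1.
    have [W0|W0] := eqVneq (fine (mu (upper_level w s))) 0.
      have -> : fine (mu (P k)) = 0.
        apply/eqP; rewrite eq_le fine_ge0 // andbT -[leRHS]W0.
        by apply: mono => //; exact: subset_trans W2.
      by rewrite mul0r mulr_ge0 ?fine_ge0 // F_ge0 // invr_ge0 fine_ge0.
    have Wp : 0 < fine (mu (upper_level w s)) by rewrite lt0r W0 fine_ge0.
    rewrite ler_pM ?fine_ge0 //; first exact: mono.
    apply: F_nondecreasing; first by rewrite invr_ge0 fine_ge0.
    by rewrite lef_pV2 ?posrE ?mono // (lt_le_trans Wp) // mono.
  rewrite -lee_fin (le_trans _ (_ : (c%:E * energy mu f + c%:E * (n%:R * (2 * s / k.+1%:R) ^+ 2)%:E <= _)%E)) //; last first.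
    by rewrite EFinD fineK // EFinM.
  rewrite -ge0_muleDr ?energy_ge0 //; last by rewrite lee_fin mulr_ge0 ?sqr_ge0.
  rewrite (@le_trans _ _ (c%:E * energy mu w)%E) //.
    by rewrite (le_trans _ Hw) // lee_fin.
  by apply: lee_wpmul2l; [rewrite lee_fin|exact: energy_cutoff].
have cH : (fine (c%:E * energy mu f) + c * (n%:R * (2 * s * k.+1%:R^-1) ^+ 2)) @[k --> \oo] -->
    fine (c%:E * energy mu f) + c * (n%:R * (2 * s * 0) ^+ 2).
  have h0 : k.+1%:R^-1 @[k --> \oo] --> (0 : R) by exact: cvg_harmonic.
  have h1 : (2 * s * k.+1%:R^-1) @[k --> \oo] --> 2 * s * 0 by apply: cvgM => //; exact: cvg_cst.
  apply: cvgD; first exact: cvg_cst.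
  apply: cvgM; first exact: cvg_cst.
  apply: cvgM; first exact: cvg_cst.
  exact: (cvgM h1 h1).
have cA : fine (mu (P k)) * Fq @[k --> \oo] --> fine (mu (upper_level f (2 * s))) * Fq.
  by apply: cvgM => //; exact: cvg_cst.
rewrite -[leRHS]fineK // lee_fin.
have -> : fine (c%:E * energy mu f) = fine (c%:E * energy mu f) + c * (n%:R * (2 * s * 0) ^+ 2).
  by rewrite mulr0 expr0n mulr0 mulr0 addr0.
by apply: (ler_cvg_to cA cH); exact: nearW.
Qed.

Variable lambda : R.
Hypotheses (lambda_ge4 : 4 <= lambda)
    (F_div_nonincreasing : forall x y, 2 <= x -> x <= y -> F y / y <= F x / x)
    (F_lambda : forall x, 2 <= x -> F (lambda * x) <= lambda * F x / 4).

Lemma capacity_admissible f (A : set (borelRn R n)) : measurable A ->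
  locally_lipschitz f -> (forall x : 'rV[R]_n, A x -> 1 <= f x) ->
  ((2^-1)%:E <= mu [set x : borelRn R n | f x = 0%R])%E ->
  ((fine (mu A) * F (fine (mu A))^-1)%:E <= (4 * lambda * D)%:E * energy mu f)%E.
Proof.
move=> mA fl Af f0; have cf := locally_lipschitz_continuous fl.
have l0 : 0 < lambda by rewrite (lt_le_trans _ lambda_ge4).
have D4 : 0 <= 4 * D by rewrite mulr_ge0.
have -> : ((4 * lambda * D)%:E * energy mu f = lambda%:E * ((4 * D)%:E * energy mu f))%E.
  by rewrite muleA -EFinM; congr (_ %:E * _)%E; ring.
have E0 : (0 <= (4 * D)%:E * energy mu f)%E by rewrite mule_ge0 ?energy_ge0.
have [->|mA0] := eqVneq (fine (mu A)) 0.
  by rewrite mul0r mule_ge0 // lee_fin ltW.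
have [->|Efin] := eqVneq ((4 * D)%:E * energy mu f)%E +oo%E.
  by rewrite gt0_muley ?lte_fin // leey.
have cfin : ((4 * D)%:E * energy mu f)%E \is a fin_num by rewrite ge0_fin_numE // ltey.
have mU t : measurable (upper_level f t) by exact: measurable_upper_level.
have fm (B : set (borelRn R n)) : measurable B -> mu B \is a fin_num by exact: fin_num_measure.
have mono (B C : set (borelRn R n)) : measurable B -> measurable C -> B `<=` C -> fine (mu B) <= fine (mu C).
  by move=> mB mC BC; rewrite fine_le ?fm // le_measure ?inE.
pose a k := fine (mu (upper_level f (2^-1 ^+ k))).
have Aa0 : fine (mu A) <= a 0%N by apply: mono => // x /Af; rewrite /upper_level /= expr0.
have Ap : 0 < fine (mu A) by rewrite lt0r mA0 fine_ge0.
have a0 : 0 < a 0%N by rewrite (lt_le_trans Ap).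
have h0 k : 0 < 2^-1 ^+ k :> R by rewrite exprn_gt0 // invr_gt0.
have a12 k : a k <= 2^-1.
  have mZ : measurable [set x : borelRn R n | f x = 0%R].
    apply: closed_measurable_rV.
    by apply: (@closed_comp _ _ f [set 0]) => [x _|]; [exact: cf|exact: closed_eq].
  have sub : upper_level f (2^-1 ^+ k) `<=` ~` [set x : borelRn R n | f x = 0%R].
    by move=> x fx /= fx0; move: fx; rewrite /upper_level /= fx0 leNgt h0.
  rewrite (le_trans (mono _ _ _ (measurableC mZ) sub)) // probability_setC //.
  rewrite -lee_fin fineK ?fin_numB ?fm // leeBlDr ?fm //.
  rewrite (@le_trans _ _ ((2^-1)%:E + (2^-1)%:E)%E) //; last by rewrite leeD2l.
  by rewrite -EFinD lee_fin; lra.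
(* At [s = 2^-(k+1)] the factor [(2 / s)^2] is [4 * 4^(k+1)]. *)
have HG : profile F (a 0%N) <= lambda * fine ((4 * D)%:E * energy mu f).
  apply: (profile_level F_nondecreasing lambda_ge4 F_div_nonincreasing F_lambda) => //.
    move=> k; apply: mono => // x; rewrite /upper_level /=; apply: le_trans.
    by rewrite exprS ler_piMl ?(ltW (h0 k)) // invf_le1 // ler1n.
  move=> k; have := sobolev_locally_lipschitz fl (h0 k.+1).
  have -> : 2 * 2^-1 ^+ k.+1 = 2^-1 ^+ k :> R by rewrite exprS mulrA divff ?mul1r.
  have -> : D * (2 / 2^-1 ^+ k.+1) ^+ 2 = 4 ^+ k.+1 * (4 * D).
    rewrite exprVn invrK exprMn -exprM mulnC exprM (_ : 2 ^+ 2 = 4 :> R); first by ring.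
    by rewrite expr2; lra.
  have -> : ((4 ^+ k.+1 * (4 * D))%:E * energy mu f = (4 ^+ k.+1)%:E * ((4 * D)%:E * energy mu f))%E.
    by rewrite muleA -EFinM.
  by rewrite -[X in (_ <= _ * X)%E]fineK // -EFinM lee_fin.
rewrite -[X in (_ <= _ * X)%E]fineK // -EFinM lee_fin (le_trans _ HG) //.
by apply: (profile_nondecreasing F_div_nonincreasing).
Qed.

End sobolev_levels.

(** * Degenerate constants and the infimum over competitors *)

Section half_spaces.
Context {R : realType} {n : nat}.
Variable mu : probability (borelRn R n) R.
Hypothesis mu_ac : mu `<< @lebesgueRn R n.
Variable i : 'I_n.

Definition half_space (t : R) : set (borelRn R n) := [set x : 'rV[R]_n | t < x 0 i].

Definition hyperplane (t : R) : set (borelRn R n) := [set x : 'rV[R]_n | x 0 i = t].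

Lemma coord_lip : lip (fun x : 'rV[R]_n => x 0 i) 1.
Proof. by move=> x y; rewrite mul1r; have := le_coord_norm (x - y) i; rewrite !mxE. Qed.

Lemma measurable_half_space t : measurable (half_space t).
Proof.
apply: measurable_open_rV.
apply: (@open_comp _ _ (fun x : 'rV[R]_n => x 0 i) [set y | t < y]); last exact: open_gt.
by move=> x _; exact: (lip_continuous coord_lip).
Qed.

Lemma measurable_hyperplane t : measurable (hyperplane t).
Proof.
apply: closed_measurable_rV.
apply: (@closed_comp _ _ (fun x : 'rV[R]_n => x 0 i) [set t]); last exact: closed_eq.
by move=> x _; exact: (lip_continuous coord_lip).
Qed.

Lemma hyperplane_null t : mu (hyperplane t) = 0%E.
Proof.
have mH := measurable_hyperplane t.
apply: (mu_null mu_ac) => //; apply/(lebesgueRn_null_slices i mH).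
rewrite (_ : fat_slices i _ = set0).
  by have [m ->] := @lebesgueRn_measure R n; rewrite measure0.
apply/seteqP; split => // x; rewrite /fat_slices /= => /eqP; apply.
rewrite (_ : slice _ _ _ = [set t]); first exact: lebesgue_measure_set1.
by apply/seteqP; split => s; rewrite /slice /hyperplane /= updE.
Qed.

(** The distribution function of a coordinate is continuous, hyperplanes being
    null, and takes the value [c] at the infimum of the [t] where the measure of
    the half-space is at most [c]. *)
Lemma half_space_of_measure (c : R) : 0 < c < 1 ->
  exists t, mu (half_space t) = c%:E.
Proof.
move=> /andP[c0 c1].
have mX : measurable_fun [set: borelRn R n] (fun x : borelRn R n => (x : 'rV[R]_n) 0 i).
  by apply: continuous_measurable_rV; exact: (lip_continuous coord_lip).
pose X : {RV mu >-> R} := mfun_Sub (mem_set mX).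
have mE t : ccdf X t = mu (half_space t).
  rewrite /ccdf /distribution /pushforward; congr (mu _).
  by apply/seteqP; split => x /=; rewrite /half_space /= in_itv /= andbT.
pose h t := fine (mu (half_space t)).
have hE t : (h t)%:E = mu (half_space t) by rewrite fineK // fin_num_measure //; exact: measurable_half_space.
have hX t : fine (ccdf X t) = h t by rewrite mE.
have hni s t : s <= t -> h t <= h s.
  move=> st; rewrite fine_le ?fin_num_measure ?le_measure ?inE //; try exact: measurable_half_space.
  by move=> x; rewrite /half_space /=; exact: le_lt_trans.
have /fine_cvgP[_ hy] := cvg_ccdfy0 X.
have /fine_cvgP[_ hNy] := cvg_ccdfNy1 X.
pose T := [set t | h t <= c].
have T0 : T !=set0.
  have [b [_ Hb]] := cvgr_lt _ hy _ c0.
  exists (b + 1); apply: ltW; rewrite -hX; apply: Hb; by rewrite ltrDl.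
have lT : has_lbound T.
  have [b [_ Hb]] := cvgr_gt _ hNy _ c1.
  exists (b - 1) => t Tt; rewrite leNgt; apply/negP => tb.
  have := Hb (b - 1); rewrite /= hX ltrBlDr ltrDl ltr01 => /(_ isT).
  by rewrite ltNge (le_trans (hni _ _ (ltW tb))).
have iT : has_inf T by split.
exists (inf T); rewrite -hE; congr (_ %:E); apply/eqP; rewrite eq_le; apply/andP; split.
- have /fine_cvgP[_ hr] : ccdf X s @[s --> (inf T)^'+] --> (h (inf T))%:E.
    by rewrite hE -mE; exact: ccdf_right_continuous.
  apply: (ler_cvg_to hr (cvg_cst c)); near=> s; rewrite /= hX.
  have s0 : inf T < s by near: s; exact: nbhs_right_gt.
  have [t Tt ts] := inf_adherent (eps := s - inf T) ltac:(by rewrite subr_gt0) iT.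
  rewrite (le_trans _ Tt) // hni // ltW //.
  by move: ts; rewrite addrC subrK.
- pose V k := half_space (inf T - k.+1%:R^-1).
  have mV k : measurable (V k) by exact: measurable_half_space.
  have VE : \bigcap_k V k = half_space (inf T) `|` hyperplane (inf T).
    apply/seteqP; split => x; rewrite /V /half_space /hyperplane /=.
      move=> H; have : inf T <= (x : 'rV[R]_n) 0 i.
        apply/ler_addgt0Pr => e e0; have [k ke] : exists k, k.+1%:R^-1 < e.
          exists (Num.truncn e^-1); rewrite -[ltRHS]invrK ltf_pV2 ?posrE ?invr_gt0 //.
          exact: truncnS_gt.
        rewrite -lerBlDr (le_trans _ (ltW (H k I))) //.
        by rewrite lerD2l lerN2 ltW.
      by rewrite le_eqVlt => /orP[/eqP <-|]; [right|left].
    move=> H k _; have k0 : 0 < k.+1%:R^-1 :> R by rewrite invr_gt0.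
    change (inf T - k.+1%:R^-1 < (x : 'rV[R]_n) 0 i).
    by case: H => [H|->]; [rewrite (lt_trans _ H)//|]; rewrite gtrDl oppr_lt0.
  have muV : mu (\bigcap_k V k) = (h (inf T))%:E.
    rewrite VE hE; apply/eqP; rewrite eq_le; apply/andP; split.
      rewrite -[leRHS]adde0 -(hyperplane_null (inf T)).
      apply: measureU2; [exact: measurable_half_space|exact: measurable_hyperplane].
    rewrite le_measure ?inE //; first exact: measurable_half_space.
    by rewrite -VE; exact: bigcapT_measurable.
  have cV : fine (mu (V k)) @[k --> \oo] --> h (inf T).
    apply: fine_cvg; rewrite -muV; apply: nonincreasing_cvg_mu => //.
    - by rewrite ltey_eq fin_num_measure.
    - exact: bigcapT_measurable.
    - move=> k l kl; apply/subsetPset => x; rewrite /V /half_space /=; apply: le_lt_trans.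
      by rewrite lerD2l lerN2 lef_pV2 ?posrE // ler_nat.
  apply: (ler_cvg_to (cvg_cst c) cV); apply: nearW => k.
  rewrite leNgt; apply/negP => /ltW Vc.
  have : inf T <= inf T - k.+1%:R^-1 by exact: ge_inf.
  by rewrite lerBrDr gerDl leNgt invr_gt0 ltr0n.
Unshelve. all: by end_near. Qed.

End half_spaces.

Lemma lip_locally_lipschitz {R : realType} {n : nat} (f : 'rV[R]_n -> R) (L : R) :
  lip f L -> locally_lipschitz f.
Proof.
move=> fL x; exists setT; first exact: filterT.
exists L; split; first exact: num_real.
move=> M LM [y z] _ /=; rewrite (le_trans (fL y z)) // ler_wpM2r // ltW //.
Qed.

Section coordinate_function.
Context {R : realType} {n : nat}.
Variable i : 'I_n.

Lemma partial_coord j x : derivable (fun y : 'rV[R]_n => y 0 i) x (delta_mx 0 j) /\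
  partialRn j (fun y : 'rV[R]_n => y 0 i) x = (j == i)%:R.
Proof.
rewrite /partialRn derivable_upd derive_upd.
have [->|ji] := eqVneq j i.
  rewrite (_ : (fun t => _) = id); last by apply/funext => t; rewrite updE.
  by split; [exact: derivable_id|rewrite derive_id].
rewrite (_ : (fun t => _) = fun=> x 0 i); last by apply/funext => t; rewrite updNE // eq_sym.
by split; [exact: derivable_cst|rewrite derive_cst].
Qed.

Lemma smooth_cst (c : R) : smooth (fun _ : 'rV[R]_n => c).
Proof.
move=> k; elim: k c => [|k IH] c /=; first exact: continuous_cst.
split; first exact: continuous_cst.
move=> j; split; first by move=> x; exact: derivable_cst.
rewrite (_ : partialRn _ _ = fun=> 0); first exact: IH.
by apply/funext => x; rewrite /partialRn derive_cst.
Qed.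

Lemma smooth_coord : smooth (fun x : 'rV[R]_n => x 0 i).
Proof.
have cc : continuous (fun x : 'rV[R]_n => x 0 i) := lip_continuous (@coord_lip R n i).
case=> [|k] //=; split => // j; split; first by move=> x; have [] := partial_coord j x.
rewrite (_ : partialRn _ _ = fun=> (j == i)%:R); first exact: smooth_cst.
by apply/funext => x; have [] := partial_coord j x.
Qed.

Lemma energy_coord (mu : probability (borelRn R n) R) :
  energy mu (fun x : 'rV[R]_n => x 0 i) = 1%E.
Proof.
rewrite /energy (eq_integral (fun=> 1%E)) => [|x _].
  by rewrite integral_cst // mul1e; exact: probability_setT.
congr (_ %:E); rewrite /sqnorm (bigD1 i) //= big1 ?addr0 => [|j ji].
  by rewrite mxE; have [_ ->] := partial_coord i x; rewrite eqxx expr1n.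
by rewrite mxE; have [_ ->] := partial_coord j x; rewrite (negbTE ji) expr0n.
Qed.

End coordinate_function.

Section sobolev_constant.
Context {R : realType} {n : nat}.
Variable mu : probability (borelRn R n) R.
Hypothesis mu_ac : mu `<< @lebesgueRn R n.
Variables (F : R -> R) (D : R).
Hypotheses (F_ge0 : forall x, 0 <= x -> 0 <= F x)
  (F_nondecreasing : forall x y, 0 <= x -> x <= y -> F x <= F y)
  (F_Sobolev : forall f : 'rV[R]_n -> R, smooth f ->
      (\int[mu]_x (f x ^+ 2 *
          F (f x ^+ 2 / fine (\int[mu]_y (f y ^+ 2)%:E)))%:E
        <= D%:E * energy mu f)%E).
Variable i : 'I_n.

(** Test the inequality on a linear coordinate, whose energy is [1]. *)
Lemma sobolev_constant_ge0 : 0 <= D.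
Proof.
have := F_Sobolev (@smooth_coord R n i); rewrite energy_coord mule1 -lee_fin.
apply: le_trans; apply: integral_ge0 => x _.
rewrite lee_fin mulr_ge0 ?sqr_ge0 // F_ge0 // divr_ge0 ?sqr_ge0 // fine_ge0 //.
by apply: integral_ge0 => y _; rewrite lee_fin sqr_ge0.
Qed.

Variable lambda : R.
Hypotheses (lambda_ge4 : 4 <= lambda)
    (F_div_nonincreasing : forall x y, 2 <= x -> x <= y -> F y / y <= F x / x)
    (F_lambda : forall x, 2 <= x -> F (lambda * x) <= lambda * F x / 4).

(** Take a half-space of measure [c].  A slightly smaller half-space has positive
    measure at most [c], and it has a competitor that vanishes off the larger one.
    With [D = 0] the inequality for this competitor says that [F] is at most [0]
    at a point beyond [1 / c]. *)
Lemma sobolev_constant_eq0 (c : R) : D = 0 -> 0 < c -> c <= 2^-1 -> F c^-1 <= 0.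
Proof.
move=> D0 c0 c12.
have [t tc] : exists t, mu (half_space i t) = c%:E.
  by apply: half_space_of_measure => //; rewrite c0 (le_lt_trans c12) // invf_lt1 // ltr1n.
pose V k := upper_level (fun x : 'rV[R]_n => x 0 i) (t + k.+1%:R^-1).
have cc : continuous (fun x : 'rV[R]_n => x 0 i) := lip_continuous (@coord_lip R n i).
have mV k : measurable (V k) by exact: measurable_upper_level.
have mH : measurable (half_space i t) by exact: measurable_half_space.
have VH k : V k `<=` half_space i t.
  by move=> x; rewrite /V /upper_level /half_space /=; apply: lt_le_trans; rewrite ltrDl invr_gt0.
have [k Vk] : exists k, mu (V k) != 0%E.
  apply/not_existsP => H.
  have : mu.-negligible (\bigcup_k V k).
    apply: negligible_bigcup => k; exists (V k); split => //.
    by apply/eqP/negP => /negP; exact: H.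
  have -> : \bigcup_k V k = half_space i t.
    apply/seteqP; split => [x [k _]|x]; first exact: VH.
    rewrite /half_space /= => tx.
    exists (Num.truncn ((x : 'rV[R]_n) 0 i - t)^-1) => //; rewrite /V /upper_level /=.
    rewrite addrC -lerBrDr -[leRHS]invrK lef_pV2 ?posrE ?invr_gt0 ?subr_gt0 //.
    by rewrite ltW // truncnS_gt.
  by move=> /(negligibleP mu mH); rewrite [LHS]tc => -[] /eqP; rewrite gt_eqF.
have k0 : 0 < k.+1%:R^-1 :> R by rewrite invr_gt0.
pose f (x : 'rV[R]_n) := clamp (k.+1%:R * (x 0 i - t)).
have fl : locally_lipschitz f.
  apply: (@lip_locally_lipschitz _ _ _ k.+1%:R) => x y.
  rewrite (le_trans (clamp_lip _ _)) // -mulrBr normrM ger0_norm // ler_wpM2l //.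
  rewrite (_ : _ - _ = x 0 i - y 0 i); last by ring.
  by rewrite (le_trans (coord_lip _ _ _)) // mul1r.
have fV (x : 'rV[R]_n) : V k x -> 1 <= f x.
  rewrite /V /upper_level /= => xk; rewrite /f clamp_eq1 //.
  by rewrite mulrC -ler_pdivrMr // mul1r lerBrDl.
have f0 : ((2^-1)%:E <= mu [set x : borelRn R n | f x = 0%R])%E.
  have cf := locally_lipschitz_continuous fl.
  rewrite (@le_trans _ _ (mu (~` half_space i t))) //.
    rewrite probability_setC // tc -EFinB lee_fin; lra.
  rewrite le_measure ?inE //.
  - exact: measurableC.
  - apply: closed_measurable_rV.
    by apply: (@closed_comp _ _ f [set 0]) => [x _|]; [exact: cf|exact: closed_eq].
  - move=> x; rewrite /half_space /= => /negP; rewrite -leNgt => xt.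
    by rewrite /f clamp_eq0 // mulr_ge0_le0 // subr_le0.
have fin : mu (V k) \is a fin_num by exact: fin_num_measure.
have a0 : 0 < fine (mu (V k)) by rewrite fine_gt0 // lt0e Vk measure_ge0 /= ltey_eq fin.
have ac : fine (mu (V k)) <= c by rewrite -lee_fin fineK // -tc le_measure ?inE.
have := capacity_admissible mu_ac F_ge0 F_nondecreasing sobolev_constant_ge0 F_Sobolev
  lambda_ge4 F_div_nonincreasing F_lambda (mV k) fl fV f0.
rewrite D0 mulr0 mul0e lee_fin pmulr_rle0 //; apply: le_trans.
by apply: F_nondecreasing; [rewrite invr_ge0 ltW|rewrite lef_pV2 ?posrE].
Qed.

End sobolev_constant.

Lemma Cap_ge0 {R : realType} {n : nat} (mu : probability (borelRn R n) R) A : (0 <= Cap mu A)%E.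
Proof. by apply: le_ereal_inf_tmp => _ [f _ <-]; exact: energy_ge0. Qed.

(** In dimension [0] there is one point, so a set of measure less than [1] is
    empty; there are no partial derivatives, and every energy is [0]. *)
Lemma Cap_dim0 {R : realType} (mu : probability (borelRn R 0) R) (A : set (borelRn R 0)) :
  mu A != 1%E -> A = set0 /\ Cap mu A = 0%E.
Proof.
move=> A1.
have A0 : A = set0.
  apply/seteqP; split => // x Ax; move: A1.
  rewrite (_ : A = setT) ?probability_setT ?eqxx //; apply/seteqP; split => // y _.
  by rewrite (_ : y = x) // [LHS]thinmx0 [RHS]thinmx0.
split => //; apply/eqP; rewrite eq_le Cap_ge0 andbT.
apply: ereal_inf_lbound; exists (fun=> 0); last first.
  by rewrite /energy; apply: integral0_eq => x _; rewrite /sqnorm big_ord0.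
split; [|by rewrite A0|].
  by apply: (@lip_locally_lipschitz _ _ _ 0) => x y; rewrite subrr normr0 mul0r.
rewrite (_ : [set x | _] = setT); last by apply/seteqP; split.
by rewrite probability_setT lee_fin invf_le1 // ler1n.
Qed.

Theorem theorem12 (R : realType) (n : nat) (mu : probability (borelRn R n) R)
    (mu_ac : mu `<< @lebesgueRn R n)
    (F : R -> R) (lambda D : R)
    (F_ge0 : forall x, 0 <= x -> 0 <= F x)
    (F_nondecreasing : forall x y, 0 <= x -> x <= y -> F x <= F y)
    (lambda_ge4 : 4 <= lambda)
    (F_div_nonincreasing : forall x y, 2 <= x -> x <= y -> F y / y <= F x / x)
    (F_lambda : forall x, 2 <= x -> F (lambda * x) <= lambda * F x / 4)
    (F_Sobolev : forall f : 'rV[R]_n -> R, smooth f ->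
      (\int[mu]_x (f x ^+ 2 *
          F (f x ^+ 2 / fine (\int[mu]_y (f y ^+ 2)%:E)))%:E
        <= D%:E * energy mu f)%E)
    (A : set (borelRn R n)) (mA : measurable A)
    (muA_le : (mu A <= (2^-1)%:E)%E) :
  ((fine (mu A) * F (fine (mu A))^-1)%:E
    <= (4 * lambda * D)%:E * Cap mu A)%E.
Proof.
case: n => [|n] in mu mu_ac F_Sobolev A mA muA_le *.
  have A1 : mu A != 1%E.
    by rewrite lt_eqF // (le_lt_trans muA_le) // lte_fin invf_lt1 // ltr1n.
  have [-> ->] := Cap_dim0 A1.
  by rewrite measure0 mul0r mule0.
have fin : mu A \is a fin_num by exact: fin_num_measure.
have D0 := sobolev_constant_ge0 F_ge0 F_Sobolev ord0.
have [A0|A0] := eqVneq (fine (mu A)) 0.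
  by rewrite A0 mul0r mule_ge0 ?Cap_ge0 // lee_fin !mulr_ge0 // (le_trans _ lambda_ge4).
have Ap : 0 < fine (mu A) by rewrite lt0r A0 fine_ge0.
(* [Cap] may be infinite, and then the right-hand side is [0 * +oo = 0]. *)
have [DE|DN0] := eqVneq D 0.
  have A12 : fine (mu A) <= 2^-1 by rewrite -lee_fin fineK.
  have := sobolev_constant_eq0 mu_ac F_ge0 F_nondecreasing F_Sobolev ord0
    lambda_ge4 F_div_nonincreasing F_lambda DE Ap A12.
  by rewrite DE mulr0 mul0e lee_fin pmulr_rle0.
have Dp : 0 < D by rewrite lt0r DN0.
have c0 : 0 < 4 * lambda * D by rewrite !mulr_gt0 // (lt_le_trans _ lambda_ge4).
rewrite -lee_pdivrMl //; apply: le_ereal_inf_tmp => _ [f [fl fA f0] <-].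
rewrite lee_pdivrMl //.
exact: (capacity_admissible mu_ac F_ge0 F_nondecreasing D0 F_Sobolev
  lambda_ge4 F_div_nonincreasing F_lambda).
Qed.
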